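(* Let $p$ be an odd prime and let $G$ be any nontrivial group of nilpotency class at most $2$ and exponent $p$. Then there exists a capable group $G_1\in\mathcal{R}_p$ that contains $G$ (that is, $G_1$ has a subgroup isomorphic to $G$). If $G$ is nonabelian and capable, then $G_1$ may be chosen so that $\operatorname{rank}(G_1^{\rm ab})\leq \operatorname{rank}(G^{\rm ab})+2$. Otherwise, $G_1$ may be chosen so that $\operatorname{rank}(G_1^{\rm ab})\leq \operatorname{rank}(G^{\rm ab})+3$.
   Context: A group $G$ is called capable if it is a central factor group, i.e. $G\cong K/Z(K)$ for some group $K$. $G^{\rm ab}=G/[G,G]$ denotes the abelianization; for a group of prime exponent $p$ it is an $\mathbb{F}_p$-vector space, and its rank is its minimal number of generators, i.e. its dimension over $\mathbb{F}_p$. A group $G$ is a central product of subgroups $C$ and $D$ if $G=CD$ and $[C,D]=\{e\}$ (direct products are a special case). The central product is called trivial if $C\subseteq D$ or $D\subseteq C$, and nontrivial otherwise. For an odd prime $p$, $\mathcal{R}_p$ denotes the class of all $p$-groups $G$ of exponent $p$ such that: (i) $G$ cannot be decomposed as a nontrivial central product; (ii) $Z(G)=[G,G]$; and (iii) whenever $\{x_1,\ldots,x_n\}\subseteq G$ is a transversal for $G/Z(G)$, there is a nontrivial relation among the nontrivial commutators of the form $[x_j,x_i]$, $1\leq i<j\leq n$. Here ''transversal for $G/Z(G)$'' means that $x_1,\ldots,x_n$ project to a basis of the $\mathbb{F}_p$-vector space $G/Z(G)$ (so every element of $G$ is uniquely $x_1^{r_1}\cdots x_n^{r_n}z$ with $0\leq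 r_i<p$ and $z\in Z(G)$), and ''nontrivial relation'' means that the family of those commutators $[x_j,x_i]$, indexed by the pairs $i<j$ with $[x_j,x_i]\neq e$, is linearly dependent over $\mathbb{F}_p$ in $[G,G]$ (coincidences between commutators with different indices count as relations). *)

(* Defs.v *)
From HB Require Import structures.
From mathcomp Require Import all_boot all_order.
From mathcomp Require Import boolp classical_sets functions cardinality.

Set Implicit Arguments.
Unset Strict Implicit.
Unset Printing Implicit Defensive.

Local Open Scope classical_set_scope.
Local Open Scope card_scope.
Local Open Scope group_scope.

(* Groups are MathComp's [groupType], so they may be infinite; subgroups are
   [Prop]-valued sets.  Commutators follow [~ x, y] = x^-1 * y^-1 * x * y. *)

Definition subgroup (G : groupType) (H : set G) : Prop :=
  [/\ H 1, forall x y, H x -> H y -> H (x * y) & forall x, H x -> H x^-1].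

Definition normal (G : groupType) (N : set G) : Prop :=
  subgroup N /\ forall x g, N x -> N (x ^ g).

Definition gen (G : groupType) (X : set G) : set G := smallest (@subgroup G) X.

Definition commutator_subgroup (G : groupType) (A B : set G) : set G :=
  gen [set [~ a, b] | a in A & b in B].

(* [lower_central G n] is the term usually written gamma_(n+1)(G). *)
Fixpoint lower_central (G : groupType) (n : nat) : set G :=
  if n is m.+1 then commutator_subgroup (@lower_central G m) [set: G]
  else [set: G].
Arguments lower_central : clear implicits.

Definition nilpotency_class_le (G : groupType) (c : nat) : Prop :=
  lower_central G c = [set 1].

Definition nontrivial (G : groupType) : Prop := exists g : G, g <> 1.

Definition abelian_group (G : groupType) : Prop := forall x y : G, commute x y.

Definition has_exponent (G : groupType) (n : nat) : Prop :=
  [/\ (0 < n)%N,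
      forall x : G, x ^+ n = 1
    & forall m, (0 < m)%N -> (forall x : G, x ^+ m = 1) -> (n <= m)%N].

Definition p_group (p : nat) (G : groupType) : Prop :=
  forall x : G, exists k : nat, x ^+ (p ^ k) = 1.

Definition isog (G H : groupType) : Prop :=
  exists f : {multiplicative G -> H}, bijective f.

Definition contains_copy (G1 G : groupType) : Prop :=
  exists2 H : set G1, subgroup H &
    exists f : {multiplicative G -> G1}, set_bij [set: G] H f.

Record normalSubgroup (G : groupType) := NormalSubgroup {
  nsub_set :> set G;
  nsubP : normal nsub_set }.

Section Quotient.
Variables (G : groupType) (N : normalSubgroup G).

Definition coset_rel (x y : G) : bool := `[< nsub_set N (x^-1 * y) >].

Fact coset_rel_equiv : equiv_class_of coset_rel.
Proof.
have [[N1 NM NV] _] := nsubP N; split=> [x|x y|y x z].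
- by apply/asboolP; rewrite mulVg.
- by apply/asboolP/asboolP => /NV; rewrite invgM invgK.
- move=> /asboolP Nxy /asboolP Nyz; apply/asboolP.
  by have := NM _ _ Nxy Nyz; rewrite mulgA mulgK.
Qed.

Canonical coset_equiv := EquivRelPack coset_rel_equiv.

Definition quot : Type := {eq_quot coset_equiv}%qT.
HB.instance Definition _ := Choice.on quot.
HB.instance Definition _ := Quotient.on quot.

Definition quot_proj (x : G) : quot := (\pi_quot x)%qT.
Definition quot_mul (a b : quot) : quot := quot_proj (repr a * repr b).
Definition quot_inv (a : quot) : quot := quot_proj (repr a)^-1.

Lemma quot_projP (x y : G) : quot_proj x = quot_proj y <-> nsub_set N (x^-1 * y).
Proof.
split=> [/eqquotP /asboolP //|Nxy]; by apply/eqquotP/asboolP.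
Qed.

Lemma quot_proj_repr (a : quot) : quot_proj (repr a) = a.
Proof. exact: reprK. Qed.

Lemma quot_mulE x y : quot_mul (quot_proj x) (quot_proj y) = quot_proj (x * y).
Proof.
have [[N1 NM NV] NJ] := nsubP N.
apply/quot_projP.
have /quot_projP Nx := quot_proj_repr (quot_proj x).
have /quot_projP Ny := quot_proj_repr (quot_proj y).
set a := repr _ in Nx *; set b := repr _ in Ny *.
have := NM _ _ Ny (NJ _ y Nx); rewrite /conjg.
by rewrite invgM !mulgA mulgK.
Qed.

Lemma quot_invE x : quot_inv (quot_proj x) = quot_proj x^-1.
Proof.
have [[N1 NM NV] NJ] := nsubP N.
apply/quot_projP.
have /quot_projP Nx := quot_proj_repr (quot_proj x).
set a := repr _ in Nx *.
have := NV _ (NJ _ a^-1 Nx).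
by rewrite /conjg !invgM !invgK !mulgA mulgK.
Qed.

Fact quot_mulA : associative quot_mul.
Proof.
move=> a b c; rewrite -[a]quot_proj_repr -[b]quot_proj_repr -[c]quot_proj_repr.
by rewrite !quot_mulE mulgA.
Qed.

Fact quot_mul1g : left_id (quot_proj 1) quot_mul.
Proof. by move=> a; rewrite -[a]quot_proj_repr quot_mulE mul1g. Qed.

Fact quot_mulg1 : right_id (quot_proj 1) quot_mul.
Proof. by move=> a; rewrite -[a]quot_proj_repr quot_mulE mulg1. Qed.

Fact quot_mulVg : left_inverse (quot_proj 1) quot_inv quot_mul.
Proof.
by move=> a; rewrite -[a]quot_proj_repr quot_invE quot_mulE mulVg.
Qed.

Fact quot_mulgV : right_inverse (quot_proj 1) quot_inv quot_mul.
Proof.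
by move=> a; rewrite -[a]quot_proj_repr quot_invE quot_mulE mulgV.
Qed.

HB.instance Definition _ := isGroup.Build quot
  quot_mulA quot_mul1g quot_mulg1 quot_mulVg quot_mulgV.

Lemma quot_projM : {morph quot_proj : x y / x * y}.
Proof. by move=> x y; rewrite -quot_mulE. Qed.

HB.instance Definition _ := isMultiplicative.Build G quot quot_proj quot_projM.

End Quotient.

Section CenterAbelianization.
Variable G : groupType.

Definition center_set : set G := [set z | forall x : G, commute z x].
Definition derived_set : set G := commutator_subgroup [set: G] [set: G].

Fact center_normal : normal center_set.
Proof.
split; first split.
- by move=> x; rewrite /commute mulg1 mul1g.
- by move=> x y Zx Zy g; apply/commute_sym/commuteM; apply/commute_sym.
- by move=> x Zx g; apply/commute_sym/commuteV/commute_sym.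
- move=> x g Zx; suff -> : x ^ g = x by [].
  by rewrite /conjg Zx mulgA mulVg mul1g.
Qed.

Fact gen_subgroup (X : set G) : subgroup (gen X).
Proof.
split=> [H [[]]//|x y Xx Xy H HX|x Xx H HX].
- by have [_ HM _] := HX.1; exact: HM (Xx H HX) (Xy H HX).
- by have [_ _ HV] := HX.1; exact: HV (Xx H HX).
Qed.

Fact derived_normal : normal derived_set.
Proof.
have sG := gen_subgroup [set [~ a, b] | a in [set: G] & b in [set: G]].
split=> // x g Dx; have [_ sM _] := sG.
have -> : x ^ g = x * [~ x, g] by rewrite /commg mulVKg.
by apply: sM => //; apply: sub_gen_smallest; exists x => //; exists g.
Qed.

Definition center : normalSubgroup G := NormalSubgroup center_normal.
Definition derived : normalSubgroup G := NormalSubgroup derived_normal.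

Definition abelianization : groupType := quot derived.

End CenterAbelianization.
Arguments center G : clear implicits.
Arguments derived G : clear implicits.

Definition capable (G : groupType) : Prop :=
  exists K : groupType, isog G (quot (center K)).

(* [X] is a generating set with the minimum number of elements, so that its
   cardinality is the rank of [G], as a possibly infinite cardinal. *)
Definition min_generating_set (G : groupType) (X : set G) : Prop :=
  gen X = [set: G] /\ forall Y : set G, gen Y = [set: G] -> X #<= Y.

(* Not used below: it shows that the rank is always defined, so that the
   comparison of ranks in [rank_le_add] is never vacuous.  It follows from
   applying Zorn's lemma to families of choice functions that pairwise differ
   everywhere. *)
Lemma min_generating_set_exists (G : groupType) :
  exists X : set G, min_generating_set X.
Proof.
pose F : set (set G) := [set Y | gen Y = [set: G]].
have FT : F [set: G] by apply/seteqP; split=> // x _; exact: sub_gen_smallest.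
pose P : set (set (set G -> G)) := [set D |
  (forall h Y, D h -> F Y -> Y (h Y)) /\
  (forall h k Y, D h -> D k -> F Y -> h Y = k Y -> h = k)].
have [D [[DY Dinj] Dmax]] : exists D, P D /\ forall B, D `<` B -> ~ P B.
  apply: Zorn_bigcup => C CP Ctot.
  split=> [h Y [D CD Dh]|h k Y [D CD Dh] [E CE Ek]].
    exact: (CP _ CD).1.
  have [DE|ED] := Ctot _ _ CD CE.
    exact: (CP _ CE).2 _ _ _ (DE _ Dh) Ek.
  exact: (CP _ CD).2 _ _ _ Dh (ED _ Ek).
have [Y0 FY0 surjD] : exists2 Y0, F Y0 &
    forall y, Y0 y -> exists2 h, D h & h Y0 = y.
  apply: contrapT => nsurj.
  have /choice[g gP] : forall Y, exists y,
      F Y -> Y y /\ forall h, D h -> h Y <> y.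
    move=> Y; have [FY|] := pselect (F Y); last by exists 1.
    apply: contrapT => ny; apply: nsurj; exists Y => // y Yy.
    apply: contrapT => nh; apply: ny; exists y => _; split=> // h Dh hy.
    by apply: nh; exists h.
  have nDg : ~ D g by move=> Dg; exact: (gP _ FT).2 Dg erefl.
  apply: (Dmax (D `|` [set g])).
    by split=> [h|/(_ g)]; [left|move/(_ (or_intror erefl))].
  split=> [h Y [Dh|->] FY|h k Y [Dh|->] [Dk|->] FY //].
  - exact: DY Dh FY.
  - exact: (gP _ FY).1.
  - exact: Dinj Dh Dk FY.
  - by move=> hg; case: ((gP _ FY).2 _ Dh hg).
  - by move=> /esym kg; case: ((gP _ FY).2 _ Dk kg).
exists Y0; split=> // Y FY.
have Y0D : Y0 #<= D.
  have -> : Y0 = [set h Y0 | h in D].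
    apply/seteqP; split=> [y /surjD[h Dh <-]|_ [h Dh <-]]; first by exists h.
    exact: DY Dh FY0.
  exact: card_image_le.
apply: (card_le_trans Y0D).
have DYinj : {in D &, injective (fun h : set G -> G => h Y)}.
  by move=> h k; rewrite !inE => Dh Dk; exact: Dinj Dh Dk FY.
have /card_eqPle[_ DleY] := inj_card_eq DYinj.
apply: (card_le_trans DleY); apply: subset_card_le => _ [h Dh <-].
exact: DY Dh FY.
Qed.

Definition rank_le_add (G H : groupType) (k : nat) : Prop :=
  forall (X : set G) (Y : set H),
    min_generating_set X -> min_generating_set Y ->
    X #<= ((inl @` Y) `|` (inr @` `I_k) : set (H + nat)).

Definition central_product (G : groupType) (C D : set G) : Prop :=
  [/\ subgroup C, subgroup D,
      forall g : G, exists c d, [/\ C c, D d & g = c * d]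
    & commutator_subgroup C D = [set 1]].

Definition trivial_decomposition (G : groupType) (C D : set G) : Prop :=
  C `<=` D \/ D `<=` C.

(* Linear independence and bases over F_p in multiplicative notation, for a
   family [b] of elements of an elementary abelian p-subgroup of [G].  Being
   about families, they count repeated values as a dependency. *)
Definition independent (p : nat) (G : groupType) (I : eqType) (b : I -> G) :
    Prop :=
  forall (s : seq I) (r : I -> nat), uniq s ->
    \prod_(i <- s) b i ^+ r i = 1 -> forall i, i \in s -> p %| r i.

Definition basis (p : nat) (G : groupType) (I : eqType) (b : I -> G) : Prop :=
  gen (range b) = [set: G] /\ independent p b.

Definition transversal (p : nat) (G : groupType) (I : eqType) (x : I -> G) :
    Prop :=
  basis p (fun i => quot_proj (center G) (x i)).

(* The index set of the nontrivial commutators [~ x_j, x_i] with i < j. *)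
Definition comm_index d (I : orderType d) (G : groupType) (x : I -> G) : eqType :=
  {ij : I * I | (ij.1 < ij.2)%O && ([~ x ij.2, x ij.1] != 1)}.

Definition nontrivial_commutators d (I : orderType d) (G : groupType)
    (x : I -> G) (ij : comm_index x) : G :=
  [~ x (val ij).2, x (val ij).1].

(* Transversals are indexed by an arbitrary totally ordered set, in order that
   the last clause also makes sense when G/Z(G) is infinite; when it is finite
   the index set may be taken to be 'I_n. *)
Definition class_R (p : nat) (G : groupType) : Prop :=
  [/\ p_group p G /\ has_exponent G p,
      forall C D : set G, central_product C D -> trivial_decomposition C D,
      center G = derived G :> set G
    & forall (d : Order.disp_t) (I : orderType d) (x : I -> G),
        transversal p x -> ~ independent p (nontrivial_commutators (x := x))].

(* Main.v *)
From HB Require Import structures.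
From mathcomp Require Import all_boot all_order all_algebra.
From mathcomp Require Import boolp classical_sets functions cardinality.
Require Import Defs.

(** A group is capable as soon as it is covered by a group whose center is the
    kernel.  Let [U = G / [G, G]], and let [G * <t>] be the coproduct of [G] and
    a cyclic group of order [p] among groups of class at most two and exponent
    [p]; its elements are triples in [G x F_p x U], the last factor being
    spanned by the commutators of [G] with [t].  Such coproducts have explicit
    covers: a further copy of [U] detects the elements of [U] through their
    commutator with [t], while the elements of [G] are detected by a cover of
    [G] if [G] is capable, and in general by replacing the first copy of [U] with
    [G] under Baer's addition [x + y = x y [y, x]^(1/2)].

    So [G * <t>] is capable and nonabelian, and we may assume this of [G] at the
    price of one generator.  Choose [u], [v] in [G] with [[u, v] <> 1] and adjoin
    two letters [a], [b] subject only to [[a, b] = [u, v]].  The result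
    retracts onto [G] by [a |-> u], [b |-> v], whence its capability.  Two
    commuting elements have proportional exponents in [a] and [b]; hence if the
    nontrivial commutators of a transversal were independent, the determinant of
    the exponents would factor through the commutator map, although it takes
    different values at [(a, b)] and [(u, v)]. *)

Set Implicit Arguments.
Unset Strict Implicit.
Unset Printing Implicit Defensive.

Import GRing.Theory.

Local Open Scope classical_set_scope.
Local Open Scope group_scope.

(** * Groups of nilpotency class at most two *)

Definition central_commutators (G : groupType) :=
  forall x y z : G, commute [~ x, y] z.

Lemma gen_min (G : groupType) (X H : set G) :
  subgroup H -> X `<=` H -> gen X `<=` H.
Proof. by move=> sH XH x; apply. Qed.

Lemma commg_derived (G : groupType) (x y : G) : derived_set [~ x, y].
Proof. by apply: sub_gen_smallest; exists x => //; exists y. Qed.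

Lemma nilpotency_class_le2 (G : groupType) :
  nilpotency_class_le G 2 -> central_commutators G.
Proof.
move=> cl2 x y z; apply/commgP/eqP.
have : lower_central G 2 [~ [~ x, y], z].
  by apply: sub_gen_smallest; exists [~ x, y]; [exact: commg_derived|exists z].
by rewrite cl2.
Qed.

Section CentralCommutators.
Variable G : groupType.
Hypothesis cl2 : central_commutators G.

Lemma commgMl (x y z : G) : [~ x * y, z] = [~ x, z] * [~ y, z].
Proof.
have -> : [~ x * y, z] = [~ x, z] ^ y * [~ y, z].
  by rewrite /commg /conjg !invgM !mulgA !mulgK.
by rewrite (conjg_fixP _) //; apply/commgP/cl2.
Qed.

Lemma commgMr (x y z : G) : [~ z, x * y] = [~ z, x] * [~ z, y].
Proof. by rewrite -invgR commgMl invgM !invgR cl2. Qed.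

Lemma commgXl (x z : G) n : [~ x ^+ n, z] = [~ x, z] ^+ n.
Proof. by elim: n => [|n IH]; rewrite ?comm1g // !expgS commgMl IH. Qed.

Lemma commgXr (x z : G) n : [~ z, x ^+ n] = [~ z, x] ^+ n.
Proof. by rewrite -invgR commgXl -expVgn invgR. Qed.

Lemma comm_commg_l (x y z : G) n : [~ [~ x, y] ^+ n, z] = 1.
Proof. by apply/eqP/commgP/commute_sym/commuteX/commute_sym/cl2. Qed.

Lemma derived_commute (x y : G) : derived_set x -> commute x y.
Proof.
move=> Dx; apply: (gen_min (center_normal G).1 _ Dx y).
by move=> _ [a _ [b _ <-]] z; apply: cl2.
Qed.

End CentralCommutators.

(** * Baer's addition *)

(** Bundling these hypotheses with the group lets the vector space structure on [baer] be declared
    as an instance. *)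
Record odd_p_class2 (p : nat) := OddPClass2 {
  class2_group :> groupType;
  class2_prime : prime p;
  class2_odd : odd p;
  class2_central : central_commutators class2_group;
  class2_exp : forall x : class2_group, x ^+ p = 1 }.

(* The Baer correspondence: [x + y = x y [y, x]^(1/2)]. *)
Definition baer p (G : odd_p_class2 p) : Type := G.

Section Baer.
Variables (p : nat) (G : odd_p_class2 p).
(** The inverse of 2 modulo [p]: raising to this power halves an element of order [p]. *)
Local Notation h := (p.+1)./2.
Let cl2 := @class2_central p G.
Let ex := @class2_exp p G.

HB.instance Definition _ := Choice.on (baer G).

Definition baer_add (x y : baer G) : baer G :=
  (x : G) * (y : G) * [~ (y : G), x] ^+ h.

Lemma half_double : h.*2 = p.+1.
Proof. by have /= := odd_double_half p.+1; rewrite (class2_odd G). Qed.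

Lemma commg_half (x y : G) : ([~ x, y] ^+ h) ^+ 2 = [~ x, y].
Proof.
by rewrite -expgnA muln2 half_double expgS ex mulg1.
Qed.

Lemma baer_add_commute (x y : G) :
  commute x y -> baer_add x y = (x * y : G).
Proof.
move=> /commute_sym/commgP/eqP cxy.
by rewrite /baer_add cxy expg1n mulg1.
Qed.

Fact baer_addA : associative baer_add.
Proof.
move=> x y z; rewrite /baer_add.
rewrite !(commgMl cl2) !(commgMr cl2) !comm_commg_l //.
rewrite [[~ z, [~ y, x] ^+ h]]commgXr // -[[~ z, [~ y, x]]]invgR.
rewrite -[[~ y, x]]expg1 comm_commg_l // invg1 !expg1n !mulg1.
have cX (a b c : G) : commute ([~ a, b] ^+ h) c.
  by apply/commute_sym/commuteX/commute_sym/cl2.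
rewrite ![([~ _, _] * _) ^+ h]expgMn; try exact: cl2.
rewrite expg1 -!mulgA; do 2 congr (_ * _).
by rewrite [[~ y, x] ^+ h * (z * _)]mulgA (cX y x z) cX -!mulgA.
Qed.

(** Since [x * y = y * x * [~ x, y]], a full commutator meets half of its inverse, and what remains
    is the half commutator in [y + x]. *)
Fact baer_addC : commutative baer_add.
Proof.
move=> x y; rewrite /baer_add [(x : G) * y]commgC -mulgA; congr (_ * _).
rewrite -{1}[[~ x, y]]commg_half expg2 -mulgA -[[~ y, x]]invgR expVgn.
by rewrite mulgV mulg1.
Qed.

Fact baer_add0 : left_id (1 : baer G) baer_add.
Proof.
move=> x; rewrite baer_add_commute ?mul1g //.
exact/commute_sym/commute1.
Qed.

Fact baer_addN :
  left_inverse (1 : baer G) (fun x : baer G => (x : G)^-1) baer_add.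
Proof.
move=> x; rewrite baer_add_commute ?mulVg //.
exact/commute_sym/commuteV/commute_refl.
Qed.

HB.instance Definition _ := GRing.isZmodule.Build (baer G)
  baer_addA baer_addC baer_add0 baer_addN.

Lemma baer_addE (x y : baer G) :
  commute (x : G) (y : G) -> (x + y)%R = (x : G) * (y : G).
Proof. exact: baer_add_commute. Qed.

Lemma baer_mulrnE (x : baer G) n : (x *+ n)%R = (x : G) ^+ n.
Proof.
elim: n => [|n IH] //.
rewrite GRing.mulrS IH baer_addE ?expgS //.
exact/commuteX/commute_refl.
Qed.

Lemma baer_mulrp (x : baer G) : (x *+ p = 0)%R.
Proof. by rewrite baer_mulrnE ex. Qed.

Lemma baer_mulr2_eq0 (x : baer G) : (x *+ 2 = 0 -> x = 0)%R.
Proof.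
have E : x = (x *+ 2 *+ h)%R; last by move=> x2; rewrite E x2 mul0rn.
by rewrite -mulrnA mul2n half_double mulrS baer_mulrp addr0.
Qed.

Lemma baer_mulrn_mod (x : baer G) n : (x *+ (n %% p) = x *+ n)%R.
Proof.
by rewrite {2}(divn_eq n p) mulrnDr mulnC mulrnA baer_mulrp mul0rn add0r.
Qed.

Definition baer_scale (a : 'F_p) (x : baer G) : baer G := (x *+ a)%R.

Let pr := class2_prime G.

Let baer_scale_nat n x : baer_scale n%:R%R x = (x *+ n)%R.
Proof. by rewrite /baer_scale val_Fp_nat // baer_mulrn_mod. Qed.

Fact baer_scaleA a b x : baer_scale a (baer_scale b x) = baer_scale (a * b)%R x.
Proof.
rewrite -[a]natr_Zp -[b]natr_Zp -natrM !baer_scale_nat.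
by rewrite mulnC mulrnA.
Qed.

Fact baer_scale1 : left_id (1%R : 'F_p) baer_scale.
Proof. by move=> x; rewrite (baer_scale_nat 1). Qed.

Fact baer_scaleDr : right_distributive baer_scale +%R.
Proof. by move=> a x y; rewrite /baer_scale mulrnDl. Qed.

Fact baer_scaleDl x : {morph baer_scale^~ x : a b / (a + b)%R}.
Proof.
move=> a b.
by rewrite -[a]natr_Zp -[b]natr_Zp -natrD !baer_scale_nat mulrnDr.
Qed.

HB.instance Definition _ := GRing.Zmodule_isLmodule.Build 'F_p (baer G)
  baer_scaleA baer_scale1 baer_scaleDr baer_scaleDl.

Lemma baer_scaleE (a : 'F_p) (x : baer G) : (a *: x)%R = (x : G) ^+ a.
Proof. by rewrite -baer_mulrnE. Qed.

Lemma baer_add_commg (x y : baer G) :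
  (x + y)%R = (x : G) * (y : G) * [~ (y : G), x] ^+ h.
Proof. by []. Qed.

End Baer.

Ltac addr_front t :=
  match goal with
  | |- _ = (?s + _)%R => unify s t
  | |- _ = ?s => unify s t
  | |- _ => first [rewrite [in RHS](addrCA _ t) | rewrite [in RHS](addrC _ t)];
            addr_front t
  end.

Ltac addr_ac_rec :=
  lazymatch goal with
  | |- (?t + _)%R = _ => addr_front t; apply: (congr1 (+%R t)); addr_ac_rec
  | |- ?t = _ => reflexivity
  end.

Ltac addr_ac := rewrite -?addrA; addr_ac_rec.

(** * Homomorphisms and capability *)

Lemma hom1 (G H : groupType) (f : G -> H) : {morph f : x y / x * y} -> f 1 = 1.
Proof.
by move=> fM; apply: (@mulgI _ (f 1)); rewrite -fM !mulg1.
Qed.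

Lemma homV (G H : groupType) (f : G -> H) :
  {morph f : x y / x * y} -> {morph f : x / x^-1}.
Proof.
by move=> fM x; apply/esym/mulg1_eq; rewrite -fM mulgV hom1.
Qed.

Lemma homX (G H : groupType) (f : G -> H) n :
  {morph f : x y / x * y} -> {morph f : x / x ^+ n}.
Proof.
by move=> fM x; elim: n => [|n IH]; rewrite ?(hom1 fM) // !expgS fM IH.
Qed.

Lemma homR (G H : groupType) (f : G -> H) :
  {morph f : x y / x * y} -> {morph f : x y / [~ x, y]}.
Proof. by move=> fM x y; rewrite /commg /conjg !(fM, homV fM). Qed.

Lemma hom_derived (G H : groupType) (f : G -> H) x :
  {morph f : x y / x * y} -> derived_set x -> derived_set (f x).
Proof.
move=> fM.
have [D1 DM DV] := gen_subgroup
  [set [~ a, b] | a in [set: H] & b in [set: H]].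
apply: (gen_min (H := [set x | derived_set (f x)])); last first.
  by move=> _ [a _ [b _ <-]]; rewrite /= homR //; exact: commg_derived.
split=> [|a b|a]; rewrite /= ?hom1 ?fM ?homV //; first exact: DM.
exact: DV.
Qed.

(** Elements of [K] agree modulo the center exactly when [f] takes the same value on them, so any
    section [s] of [f] induces an isomorphism onto the central quotient, with inverse induced by
    [f]. *)
Lemma capable_of_cover (K G : groupType) (f : K -> G) :
  {morph f : x y / x * y} -> (forall g, exists k, f k = g) ->
  (forall k, f k = 1 <-> center_set k) -> capable G.
Proof.
move=> fM /choice[s fs] ker; exists K.
pose f0 g := quot_proj (center K) (s g).
have projE k l : quot_proj (center K) k = quot_proj (center K) l <-> f k = f l.
  rewrite quot_projP /= -ker fM homV //; split=> [/mulg1_eq|->].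
    by rewrite invgK.
  by rewrite mulVg.
have f0M : {morph f0 : x y / x * y}.
  move=> x y; rewrite /f0 -quot_projM; apply/projE.
  by rewrite fM !fs.
pose fm := isMultiplicative.Build _ _ f0 f0M.
pose fh : {multiplicative G -> quot (center K)} := HB.pack f0 fm.
exists fh.
exists (fun q : quot (center K) => f (repr q)) => [g|q] /=.
  by rewrite -[RHS]fs; apply/projE/quot_proj_repr.
by rewrite -[RHS]quot_proj_repr; apply/projE; rewrite fs.
Qed.

Lemma capable_cover (G : groupType) : capable G ->
  exists (K : groupType) (f : K -> G), [/\ {morph f : x y / x * y},
    forall g, exists k, f k = g & forall k, f k = 1 <-> center_set k].
Proof.
move=> [K [f [g fK gK]]]; exists K, (fun k => g (quot_proj (center K) k)).
have gM : {morph g : x y / x * y} by apply: can2_gmulfM fK gK.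
split=> [x y|x|k]; first by rewrite quot_projM gM.
  by exists (repr (f x)); rewrite quot_proj_repr.
rewrite -(hom1 gM); split=> [/(can_inj gK)|Zk]; last first.
  by congr (g _); apply/esym/quot_projP; rewrite /= invg1 mul1g.
by move/esym/quot_projP; rewrite /= invg1 mul1g.
Qed.

(* [P] acts on [N] from the right. *)
Record factor_set (P : groupType) (N : zmodType) := FactorSet {
  fs_act : N -> P -> N;
  fs_fun : P -> P -> N;
  fs_actD : forall m n p, fs_act (m + n)%R p = (fs_act m p + fs_act n p)%R;
  fs_act1 : forall n, fs_act n 1 = n;
  fs_actM : forall n p q, fs_act n (p * q) = fs_act (fs_act n p) q;
  fs_fun1g : forall p, fs_fun 1 p = 0%R;
  fs_fung1 : forall p, fs_fun p 1 = 0%R;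
  fs_cocycle : forall p q r,
    (fs_act (fs_fun p q) r + fs_fun (p * q) r =
     fs_fun q r + fs_fun p (q * r))%R }.

Definition extension P N (D : factor_set P N) : Type := (P * N)%type.

(** * The group law on an extension with abelian kernel *)

Section Extension.
Variables (P : groupType) (N : zmodType) (D : factor_set P N).
Local Notation E := (extension D).
Local Notation act := (fs_act D).
Local Notation f := (fs_fun D).

HB.instance Definition _ := Choice.on E.

Definition ext_mul (a b : E) : E :=
  (a.1 * b.1, (act a.2 b.1 + b.2 + f a.1 b.1)%R).
Definition ext_one : E := (1, 0%R).
Definition ext_inv (a : E) : E :=
  (a.1^-1, (- act a.2 a.1^-1 - f a.1 a.1^-1)%R).

Let act0 p : act 0%R p = 0%R.
Proof. by apply: (addrI (act 0 p)); rewrite -fs_actD !addr0. Qed.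

Let actN n p : act (- n)%R p = (- act n p)%R.
Proof. by apply: (addrI (act n p)); rewrite -fs_actD !subrr act0. Qed.

Fact ext_mulA : associative ext_mul.
Proof.
move=> [p n] [q m] [r l]; rewrite /ext_mul /= mulgA; congr (_, _).
rewrite !fs_actD -!fs_actM.
have := fs_cocycle D p q r; set u := act (f p q) r; set v := f q r.
set w := f p _; set w' := f _ r; move=> E.
transitivity (act n (q * r) + act m r + l + (v + w))%R; first by addr_ac.
by rewrite -E; addr_ac.
Qed.

Fact ext_mul1g : left_id ext_one ext_mul.
Proof.
by move=> [p n]; rewrite /ext_mul /= mul1g act0 add0r fs_fun1g addr0.
Qed.

Fact ext_mulg1 : right_id ext_one ext_mul.
Proof.
by move=> [p n]; rewrite /ext_mul /= mulg1 fs_act1 fs_fung1 !addr0.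
Qed.

Fact ext_mulgV : right_inverse ext_one ext_inv ext_mul.
Proof.
move=> [p n]; rewrite /ext_mul /= mulgV; congr (_, _).
by rewrite addrA subrr add0r addNr.
Qed.

Fact ext_mulVg : left_inverse ext_one ext_inv ext_mul.
Proof.
move=> [p n]; rewrite /ext_mul /= mulVg; congr (_, _).
rewrite fs_actD !actN -fs_actM mulVg fs_act1.
(* At [(p, p^-1, p)] the cocycle identity reads [act (f p p^-1) p = f p^-1 p], which makes the right
   inverse a left inverse. *)
have := fs_cocycle D p p^-1 p.
rewrite mulgV mulVg fs_fun1g fs_fung1 !addr0 => ->.
by rewrite addrAC subrK addNr.
Qed.

HB.instance Definition _ := isGroup.Build E
  ext_mulA ext_mul1g ext_mulg1 ext_mulVg ext_mulgV.

Lemma ext_mulE (a b : E) :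
  a * b = (a.1 * b.1, (act a.2 b.1 + b.2 + f a.1 b.1)%R).
Proof. by []. Qed.

End Extension.

(** * Central extensions given by a bilinear map *)

Section BilinearExtension.
Variables (P : groupType) (R : comNzRingType) (M : lmodType R).
Variables (al : P -> R) (x : P -> M).
Hypothesis alM : forall p q, al (p * q) = (al p + al q)%R.
Hypothesis xM : forall p q, x (p * q) = (x p + x q)%R.

Lemma log1 (V : zmodType) (l : P -> V) :
  (forall p q, l (p * q) = (l p + l q)%R) -> l 1 = 0%R.
Proof.
by move=> lM; apply: (addrI (l 1)); rewrite -lM mulg1 addr0.
Qed.

Lemma logV (V : zmodType) (l : P -> V) :
  (forall p q, l (p * q) = (l p + l q)%R) -> forall p, l p^-1 = (- l p)%R.
Proof.
by move=> lM p; apply: (addrI (l p)); rewrite -lM mulgV log1 // subrr.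
Qed.

Lemma logX (V : zmodType) (l : P -> V) :
  (forall p q, l (p * q) = (l p + l q)%R) ->
  forall p n, l (p ^+ n) = (l p *+ n)%R.
Proof.
move=> lM p; elim=> [|n IH]; first by rewrite log1.
by rewrite expgS lM IH mulrS.
Qed.

Lemma logR (V : zmodType) (l : P -> V) :
  (forall p q, l (p * q) = (l p + l q)%R) -> forall p q, l [~ p, q] = 0%R.
Proof.
move=> lM p q; rewrite !lM !logV //.
by rewrite [(l p + l q)%R]addrC addKr addNr.
Qed.

Fact bilinear_fun1g p : (al p *: x 1 = 0)%R.
Proof. by rewrite log1 // scaler0. Qed.

Fact bilinear_fung1 p : (al 1 *: x p = 0)%R.
Proof. by rewrite log1 // scale0r. Qed.

Fact bilinear_cocycle p q r :
  (al q *: x p + al r *: x (p * q) = al r *: x q + al (q * r) *: x p)%R.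
Proof. by rewrite alM xM scalerDr scalerDl; addr_ac. Qed.

(** Over commuting [p] and [q], the commutator in this central extension is
    [al q *: x p - al p *: x q]. *)
Definition bilinear_factor_set : factor_set P M :=
  @FactorSet P M (fun m _ => m) (fun p q => al q *: x p)%R
    (fun _ _ _ => erefl) (fun _ => erefl) (fun _ _ _ => erefl)
    bilinear_fun1g bilinear_fung1 bilinear_cocycle.

Definition bilinear_ext := extension bilinear_factor_set.
HB.instance Definition _ := Group.on bilinear_ext.

Lemma bilinear_mulE (a b : bilinear_ext) :
  a * b = (a.1 * b.1, (a.2 + b.2 + al b.1 *: x a.1)%R).
Proof. by []. Qed.

Lemma bilinear_commuteP (a b : bilinear_ext) :
  commute a b <->
  commute a.1 b.1 /\ (al b.1 *: x a.1 = al a.1 *: x b.1)%R.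
Proof.
rewrite /commute !bilinear_mulE; split=> [[-> E]|[-> ->]].
  by split=> //; move: E; rewrite [(b.2 + _)%R]addrC => /addrI.
by rewrite [(b.2 + _)%R]addrC.
Qed.

Lemma bilinear_fst_mul : {morph (fst : bilinear_ext -> P) : a b / a * b}.
Proof. by []. Qed.

Lemma bilinear_class2 :
  central_commutators P -> central_commutators bilinear_ext.
Proof.
move=> cl2 a b c; apply/bilinear_commuteP.
rewrite (homR bilinear_fst_mul); split; first exact: cl2.
by rewrite !logR // scaler0 scale0r.
Qed.

(** ['C(n, 2)] counts the pairs of factors, each of which contributes one value of the cocycle. *)
Lemma bilinear_expg (a : bilinear_ext) n :
  a ^+ n = (a.1 ^+ n, (a.2 *+ n + (al a.1 *: x a.1) *+ 'C(n, 2))%R).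
Proof.
elim: n => [|n IH]; first by rewrite !mulr0n addr0.
rewrite !expgS IH bilinear_mulE /= logX //; congr (_, _).
rewrite binS bin1 mulrnDr mulrS -scalerMnl.
by addr_ac.
Qed.

(** Oddness makes ['C(n, 2)] a multiple of [n]. *)
Lemma bilinear_exponent n : odd n -> (forall p : P, p ^+ n = 1) ->
  (forall m : M, m *+ n = 0)%R -> forall a : bilinear_ext, a ^+ n = 1.
Proof.
move=> on Pn Mn a; rewrite bilinear_expg Pn Mn bin2odd // mulrnA Mn.
by rewrite mul0rn addr0.
Qed.

Lemma bilinear_derived (p q : P) :
  commute p q -> al p = 0%R ->
  derived_set ((1, (al q *: x p)%R) : bilinear_ext).
Proof.
move=> cpq ap.
suff -> : ((1, (al q *: x p)%R) : bilinear_ext) =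
  [~ (p, 0%R) : bilinear_ext, (q, 0%R) : bilinear_ext].
  exact: commg_derived.
apply: (@mulgI _ (((q, 0%R) : bilinear_ext) * ((p, 0%R) : bilinear_ext))).
rewrite -commgC !bilinear_mulE /= log1 // scale0r ap scale0r mulg1 cpq.
by rewrite !addr0 add0r.
Qed.

Lemma bilinear_shift (a b : bilinear_ext) : a.1 = b.1 ->
  a = b * ((1, (a.2 - b.2)%R) : bilinear_ext).
Proof.
case: a b => [p m] [q n] /= ->; rewrite bilinear_mulE /= mulg1.
by rewrite log1 // scale0r addr0 addrC subrK.
Qed.

Lemma bilinear_fstX (a : bilinear_ext) n : (a ^+ n).1 = a.1 ^+ n.
Proof. by rewrite bilinear_expg. Qed.

End BilinearExtension.

(** * Capability of bilinear extensions *)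

Section Cover.
Variables (R : comNzRingType) (P Q : groupType) (M N : lmodType R).
Variables (al : P -> R) (x : P -> N).
Hypothesis alM : forall p q, al (p * q) = (al p + al q)%R.
Hypothesis xM : forall p q, x (p * q) = (x p + x q)%R.
(** The data for a cover: a group [Q] over [P], a module [M] over [N] on which [Q] acts within the
    fibres of [rho], and a crossed homomorphism [y] lifting [x]. The element [q0] below has exponent
    1 and acts trivially on [M], so commuting with it will detect [y]. *)
Variables (phi : Q -> P) (act : M -> Q -> M) (rho : M -> N) (y : Q -> M).
Hypothesis phiM : {morph phi : a b / a * b}.
Hypothesis phi_surj : forall p, exists q, phi q = p.
Hypothesis actD : forall m n q, act (m + n)%R q = (act m q + act n q)%R.
Hypothesis actZ : forall a m q, act (a *: m)%R q = (a *: act m q)%R.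
Hypothesis act1 : forall m, act m 1 = m.
Hypothesis actM : forall m q r, act m (q * r) = act (act m q) r.
Hypothesis rhoD : forall m n, rho (m + n)%R = (rho m + rho n)%R.
Hypothesis rhoZ : forall a m, rho (a *: m)%R = (a *: rho m)%R.
Hypothesis rho_act : forall m q, rho (act m q) = rho m.
Hypothesis rho_surj : forall n, exists m, rho m = n.
Hypothesis yM : forall q r, y (q * r) = (act (y q) r + y r)%R.
Hypothesis xy : forall q, x (phi q) = rho (y q).
Variable q0 : Q.
Hypothesis al_q0 : al (phi q0) = 1%R.
Hypothesis act_q0 : forall m, act m q0 = m.
Hypothesis two_reg : forall n : N, (n *+ 2 = 0 -> n = 0)%R.
Hypothesis N_faithful : forall a : R, (forall n : N, a *: n = 0)%R -> a = 0%R.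
Hypothesis ker_phi : forall q, phi q = 1 ->
  [/\ center_set q, y q = 0%R & forall m, act m q = m].
Hypothesis ker_rho : forall m q, rho m = 0%R -> act m q = m.
Hypothesis center_ker_phi : forall q,
  center_set q -> y q = 0%R -> al (phi q) = 0%R -> phi q = 1.

(* A letter [t] acts on [M * N] by [(m, n) |-> (m, n + 2 rho m)], and its
   commutator with [q] is [(y q, rho (y q))]; summing over the powers of [t]
   gives the commutator with [t^a] as [(a y q, a^2 rho (y q))].  The factor 2
   avoids binomial coefficients. *)
Let be q := al (phi q).
Let beM q r : be (q * r) = (be q + be r)%R.
Proof. by rewrite /be phiM alM. Qed.

Definition cover_act (m : M * N) (q : Q) : M * N :=
  (act m.1 q, m.2 + (be q *+ 2) *: rho m.1)%R.
Definition cover_fun (p q : Q) : M * N :=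
  (be q *: act (y p) q, (be q) ^+ 2 *: rho (y p))%R.

Let be1 : be 1 = 0%R. Proof. exact: log1. Qed.
Let y1 : y 1 = 0%R.
Proof. by apply: (addrI (y 1)); rewrite -{1}(act1 (y 1)) -yM mulg1 addr0. Qed.
Let rho0 : rho 0%R = 0%R.
Proof. by apply: (addrI (rho 0)%R); rewrite -rhoD !addr0. Qed.
Let act0 q : act 0%R q = 0%R.
Proof. by apply: (addrI (act 0 q)%R); rewrite -actD !addr0. Qed.

Fact cover_actD m n q :
  cover_act (m + n)%R q = (cover_act m q + cover_act n q)%R.
Proof.
by congr (_, _); rewrite /= ?actD // rhoD scalerDr; addr_ac.
Qed.

Fact cover_act1 m : cover_act m 1 = m.
Proof.
by case: m => m n; rewrite /cover_act /= act1 be1 mul0rn scale0r addr0.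
Qed.

Fact cover_actM m q r : cover_act m (q * r) = cover_act (cover_act m q) r.
Proof.
congr (_, _); rewrite /= ?actM // rho_act beM mulrnDl scalerDl.
by addr_ac.
Qed.

Fact cover_fun1g q : cover_fun 1 q = 0%R.
Proof. by rewrite /cover_fun y1 act0 rho0 !scaler0. Qed.

Fact cover_fung1 q : cover_fun q 1 = 0%R.
Proof. by rewrite /cover_fun be1 expr0n !scale0r. Qed.

Fact cover_cocycle p q r :
  (cover_act (cover_fun p q) r + cover_fun (p * q) r =
   cover_fun q r + cover_fun p (q * r))%R.
Proof.
congr (_, _); rewrite /= ?yM.
  rewrite actZ actD !actM beM scalerDr scalerDl; addr_ac.
(* The cross term of [(be q + be r) ^+ 2] is supplied by the factor 2 in [cover_act]. *)
rewrite rhoZ !rhoD !rho_act beM sqrrD scalerA mulrnAl.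
rewrite [(be r * _)%R]mulrC !mulr2n !scalerDr !scalerDl.
by addr_ac.
Qed.

Definition cover_factor_set : factor_set Q (M * N)%type :=
  FactorSet cover_actD cover_act1 cover_actM cover_fun1g cover_fung1
    cover_cocycle.

Definition capability_cover := extension cover_factor_set.
HB.instance Definition _ := Group.on capability_cover.

Definition cover_proj (k : capability_cover) : bilinear_ext alM xM :=
  (phi k.1, rho k.2.1).

Lemma cover_projM : {morph cover_proj : a b / a * b}.
Proof.
move=> a b; rewrite /cover_proj /= phiM !rhoD rhoZ !rho_act.
by rewrite bilinear_mulE /= xy.
Qed.

Lemma bilinear_ext_capable : capable (bilinear_ext alM xM).
Proof.
apply: (capable_of_cover cover_projM) => [[p n]|].
  have [q <-] := phi_surj p; have [m <-] := rho_surj n.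
  by exists (q, (m, 0%R)).
move=> [q [m n]]; split.
  case=> phq rm [r [m' n']].
  have [Zq yq aq] := ker_phi phq.
  have bq : be q = 0%R by rewrite /be phq log1.
  rewrite /commute !ext_mulE /= /cover_act /cover_fun /= yq bq aq.
  rewrite Zq act0 rm rho0 ker_rho // mul0rn expr0n !scale0r !scaler0 !addr0.
  by congr (_, (_, _)); rewrite addrC.
move=> Zk.
have Zq : center_set q.
  by move=> r; have := Zk (r, 0%R); rewrite /commute !ext_mulE => -[].
(* Commuting with [(1, (m', 0))] says that [be q] times twice [rho m'] vanishes, and [rho m'] runs
   over all of [N]. *)
have bq : be q = 0%R.
  apply: N_faithful => n'; apply: two_reg; have [m' <-] := rho_surj n'.
  have := Zk (1, (m', 0%R)); rewrite /commute !ext_mulE /= => -[_ _].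
  rewrite y1 rho0 be1 mul0rn expr0n !scale0r !scaler0 !addr0 add0r.
  rewrite -{1}[n]add0r => /addIr/esym.
  by rewrite scalerMnl.
(* Once [be q = 0], commuting with [q0] gives [y q = 0] in the first copy and then twice [rho m = 0]
   in the second. *)
have := Zk (q0, 0%R); rewrite /commute !ext_mulE /= => -[_].
rewrite bq act_q0 act0 /be al_q0 rho0 expr0n !scale0r !scaler0 !addr0 !add0r.
rewrite act_q0 scale1r expr1n scale1r => /eqP.
rewrite -subr_eq0 addrAC subrr add0r => /eqP yq.
rewrite yq rho0 addr0 => /eqP.
rewrite -subr_eq0 addrAC subrr add0r scaler_nat => /eqP/two_reg rm.
by rewrite /cover_proj /= rm center_ker_phi.
Qed.

End Cover.

(** * Generators modulo the derived subgroup *)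

(** The derived subgroup is included among the generators because only the rank of the
    abelianization of [H] is to be bounded. *)
Definition extends_by (k : nat) (H G : groupType) : Prop :=
  exists f : G -> H, [/\ {morph f : x y / x * y}, injective f &
    exists2 l : seq H, size l = k &
      gen (range f `|` [set` l] `|` @derived_set H) = [set: H]].

Lemma extends_by_comp j k (L H G : groupType) :
  extends_by j L H -> extends_by k H G -> extends_by (k + j) L G.
Proof.
move=> [f [fM fI [lf sf genf]]] [g [gM gI [lg sg geng]]].
exists (f \o g); split; first by move=> x y /=; rewrite gM fM.
  exact: inj_comp.
exists (map f lg ++ lf); first by rewrite size_cat size_map sf sg.
set X := _ `|` @derived_set L.
have sX : subgroup (gen X) by exact: gen_subgroup.
have fX h : gen X (f h).
  have : gen (range g `|` [set` lg] `|` @derived_set H) h by rewrite geng.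
  apply: (gen_min (H := [set h | gen X (f h)])) => [|{}h].
    have [X1 XM XV] := sX; split=> [|a b|a]; rewrite /= ?hom1 ?fM ?homV //.
      exact: XM.
    exact: XV.
  move=> [[[a _ <-]|lh]|Dh]; apply: sub_gen_smallest.
  - by left; left; exists a.
  - by left; right; rewrite /= mem_cat map_f.
  - by right; exact: hom_derived.
apply/seteqP; split=> // x _.
have : gen (range f `|` [set` lf] `|` @derived_set L) x by rewrite genf.
apply: (gen_min sX) => y [[[a _ <-] //|ly]|Dy]; apply: sub_gen_smallest.
  by left; right; rewrite /= mem_cat ly orbT.
by right.
Qed.

(** A minimal generating set of the abelianization of [G] and the [k] extra elements together have
    images generating the abelianization of [H]. *)
Lemma extends_by_rank k (H G : groupType) : extends_by k H G ->
  rank_le_add (abelianization H) (abelianization G) k.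
Proof.
move=> [f [fM _ [l sl genl]]] X Y [_ Xmin] [genY _].
pose g (y : abelianization G) : abelianization H :=
  quot_proj (derived H) (f (repr y)).
have gE x : g (quot_proj (derived G) x) = quot_proj (derived H) (f x).
  apply/quot_projP; rewrite /= -(homV fM) -fM; apply: hom_derived => //.
  exact: (quot_projP (derived G) _ _).1 (quot_proj_repr _).
pose S : set (abelianization H) :=
  (g @` Y) `|` [set` map (quot_proj (derived H)) l].
have [S1 SM SV] := gen_subgroup S.
have gS y : gen S (g y).
  have : gen Y y by rewrite genY.
  apply: (gen_min (H := [set y | gen S (g y)])) => [|{}y Yy]; last first.
    by apply: sub_gen_smallest; left; exists y.
  have gM : {morph g : x y / x * y}.
    move=> a b; rewrite -[a]quot_proj_repr -[b]quot_proj_repr -quot_projM.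
    by rewrite !gE -quot_projM fM.
  split=> [|a b|a]; rewrite /= ?hom1 ?gM ?homV //; [exact: SM|exact: SV].
have genS : gen S = [set: abelianization H].
  apply/seteqP; split=> // q _; rewrite -[q]quot_proj_repr.
  have : gen (range f `|` [set` l] `|` @derived_set H) (repr q) by rewrite genl.
  apply: (gen_min (H := [set x | gen S (quot_proj (derived H) x)])) => [|x].
    have qM := @quot_projM H (derived H).
    split=> [|a b|a]; rewrite /= ?(hom1 qM) ?(homV qM) ?qM //.
      exact: SM.
    exact: SV.
  move=> [[[a _ <-]|lx]|Dx]; rewrite /=.
  - by rewrite -gE.
  - by apply: sub_gen_smallest; right; rewrite /= map_f.
  - suff -> : quot_proj (derived H) x = quot_proj (derived H) 1.
      by rewrite (hom1 (@quot_projM H (derived H))).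
    apply/quot_projP; rewrite /= mulg1.
    by have [_ _] := (derived_normal H).1; apply.
apply: (card_le_trans (Xmin _ genS)).
(* A surjection from the disjoint union onto [S]; on indices below [k] the default of [nth] does not
   occur. *)
pose u (z : abelianization G + nat) :=
  match z with inl y => g y
  | inr i => nth 1 (map (quot_proj (derived H)) l) i end.
have -> : S = u @` ((inl @` Y) `|` (inr @` `I_k)).
  apply/seteqP; split=> [q|q [z [[y Yy <-]|[i ik <-]] <-]].
  - move=> [[y Yy <-]|/(nthP 1)[i]].
      by exists (inl y) => //; left; exists y.
    rewrite size_map sl => ik <-; exists (inr i) => //.
    by right; exists i.
  - by left; exists y.
  - by right; rewrite /= mem_nth // size_map sl.
exact: card_image_le.
Qed.

(** A multiplicative copy of an additive group, so that exponents can form a direct factor of a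
    [groupType]. *)
Definition addgroup (V : zmodType) : Type := V.

Section AddGroup.
Variable V : zmodType.
HB.instance Definition _ := Choice.on (addgroup V).
HB.instance Definition _ := isGroup.Build (addgroup V)
  (@addrA V) (@add0r V) (@addr0 V) (@addNr V) (@addrN V).
End AddGroup.

(** * The abelianization as a vector space *)

Section AbelianizationModule.
Variables (p : nat) (G : odd_p_class2 p).

Fact ab_class2 : central_commutators (abelianization G).
Proof.
move=> x y z; suff -> : [~ x, y] = 1 by exact/commute_sym/commute1.
rewrite -[x]quot_proj_repr -[y]quot_proj_repr.
rewrite -(homR (@quot_projM G (derived G))) -(hom1 (@quot_projM G (derived G))).
apply/quot_projP; rewrite /= mulg1 invgR; exact: commg_derived.
Qed.

Fact ab_exp (x : abelianization G) : x ^+ p = 1.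
Proof.
rewrite -[x]quot_proj_repr -(homX _ (@quot_projM G (derived G))).
by rewrite class2_exp (hom1 (@quot_projM G (derived G))).
Qed.

(** On an abelian group Baer's addition is the multiplication itself, so this packaging turns the
    abelianization into an ['F_p]-space. *)
Definition ab_module : odd_p_class2 p :=
  OddPClass2 (class2_prime G) (class2_odd G) ab_class2 ab_exp.

Definition ab_proj (g : G) : baer ab_module := quot_proj (derived G) g.

Lemma ab_commute (x y : abelianization G) : commute x y.
Proof.
rewrite -[x]quot_proj_repr -[y]quot_proj_repr /commute -!quot_projM.
apply/quot_projP; rewrite /= invgM -mulgA; exact: commg_derived.
Qed.

Lemma ab_projM (g h : G) : ab_proj (g * h) = (ab_proj g + ab_proj h)%R.
Proof. by rewrite baer_addE; [exact: quot_projM|exact: ab_commute]. Qed.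

Lemma ab_proj_eq0 (g : G) : ab_proj g = 0%R <-> derived_set g.
Proof.
have [_ _ DV] := (derived_normal G).1.
rewrite -[0%R](hom1 (@quot_projM G (derived G))); split.
  by move/quot_projP; rewrite /= mulg1 => /DV; rewrite invgK.
by move=> Dg; apply/quot_projP; rewrite /= mulg1; apply: DV.
Qed.

Lemma ab_proj_surj (u : baer ab_module) : exists g, ab_proj g = u.
Proof. by exists (repr (u : abelianization G)); exact: quot_proj_repr. Qed.

End AbelianizationModule.

(** * Half of the conjugation action on the Baer module *)

Section HalfCommutator.
Variables (p : nat) (G : odd_p_class2 p).
Let cl2 := @class2_central p G.

Definition half_commg (m : baer G) (g : G) : baer G :=
  [~ (m : G), g] ^+ (p.+1)./2.

Lemma half_commg_central m g (h : G) : commute (half_commg m g : G) h.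
Proof. exact/commute_sym/commuteX/commute_sym/cl2. Qed.

Lemma half_commgD m n g :
  half_commg (m + n)%R g = (half_commg m g + half_commg n g)%R.
Proof.
rewrite [RHS]baer_addE; last exact: half_commg_central.
rewrite baer_add_commg /half_commg !(commgMl cl2) comm_commg_l // mulg1.
by rewrite expgMn //; apply: cl2.
Qed.

Lemma half_commgM m g h :
  half_commg m (g * h) = (half_commg m g + half_commg m h)%R.
Proof.
rewrite [RHS]baer_addE; last exact: half_commg_central.
by rewrite /half_commg (commgMr cl2) expgMn //; apply: cl2.
Qed.

Lemma half_commg_eq1 m g : commute (m : G) g -> half_commg m g = 0%R.
Proof. by move=> /commgP/eqP c; rewrite /half_commg c expg1n. Qed.

(** Midway between the trivial action and conjugation, which in Baer's notation is [m +
    [~ m, g]]. *)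
Definition half_conjg (m : baer G) (g : G) : baer G := (m + half_commg m g)%R.

Lemma half_conjgD m n g :
  half_conjg (m + n)%R g = (half_conjg m g + half_conjg n g)%R.
Proof. by rewrite /half_conjg half_commgD; addr_ac. Qed.

Lemma half_conjgZ a m g : half_conjg (a *: m)%R g = (a *: half_conjg m g)%R.
Proof.
have half_conjgMn k : half_conjg (m *+ k)%R g = (half_conjg m g *+ k)%R.
  elim: k => [|k IH]; last by rewrite !mulrS half_conjgD IH.
  by rewrite /half_conjg half_commg_eq1 ?addr0 //; exact/commute_sym/commute1.
exact: half_conjgMn.
Qed.

Lemma half_conjg1 m : half_conjg m 1 = m.
Proof. by rewrite /half_conjg half_commg_eq1 ?addr0 //; exact/commute1. Qed.

Lemma half_conjgM m g h : half_conjg m (g * h) = half_conjg (half_conjg m g) h.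
Proof.
rewrite /half_conjg half_commgD half_commgM.
by rewrite [half_commg (half_commg _ _) _]half_commg_eq1 ?addr0 ?addrA;
  last exact: half_commg_central.
Qed.

(** Baer's formula solved for the product: the identity of [G] is a crossed homomorphism for the
    half action, as required of [y] in the cover. *)
Lemma mulg_half_conjg (g h : baer G) :
  ((g : G) * (h : G) : G) = (half_conjg g h + h)%R.
Proof.
rewrite /half_conjg addrAC baer_addE; last exact/commute_sym/half_commg_central.
rewrite baer_add_commg /half_commg -[[~ (h : G), g]]invgR expVgn.
by rewrite mulgVK.
Qed.

Lemma ab_projD (m n : baer G) :
  ab_proj (m + n)%R = (ab_proj (m : G) + ab_proj (n : G))%R.
Proof.
rewrite baer_add_commg ab_projM ab_projM (logX (@ab_projM p G)).
rewrite (logR (@ab_projM p G)).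
by rewrite mul0rn addr0.
Qed.

Lemma ab_projZ a (m : baer G) :
  ab_proj (a *: m)%R = (a *: ab_proj (m : G))%R.
Proof. by rewrite baer_scaleE (logX (@ab_projM p G)). Qed.

Lemma ab_proj_half_conjg (m : baer G) g :
  ab_proj (half_conjg m g) = ab_proj (m : G).
Proof.
rewrite /half_conjg ab_projD /half_commg (logX (@ab_projM p G)).
rewrite (logR (@ab_projM p G)).
by rewrite mul0rn addr0.
Qed.

End HalfCommutator.

(** If every element were in the derived subgroup, every element would be central, all commutators
    would vanish and [G] would be trivial. *)
Lemma not_derived (G : groupType) :
  central_commutators G -> nontrivial G -> exists g : G, ~ derived_set g.
Proof.
move=> cl2 [g g1]; apply: contrapT => /forallNP nD.
have D (x : G) : derived_set x by exact: contrapT (nD x).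
apply: g1; apply: (gen_min (H := [set 1]) _ _ (D g)).
  split=> // [x y -> ->|x ->]; first by rewrite mulg1.
  by rewrite invg1.
by move=> _ [a _ [b _ <-]]; apply/eqP/commgP; exact: derived_commute.
Qed.

Lemma baer_scale_inj p (G : odd_p_class2 p) (a : 'F_p) (m : baer G) :
  (a *: m = 0 -> m <> 0 -> a = 0)%R.
Proof.
move=> am m0; apply/eqP; apply: contra_notT m0 => a0.
have u : a \is a GRing.unit.
  have pr := class2_prime G.
  by rewrite unitfE.
by rewrite -[m]scale1r -(mulVr u) -scalerA am scaler0.
Qed.

Lemma addgroupX (G : groupType) (V : zmodType) (g : G) (v : V) n :
  ((g, v) : G * addgroup V) ^+ n = (g ^+ n, (v *+ n)%R).
Proof. by elim: n => [|n IH] //; rewrite !expgS IH mulrS. Qed.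

(** * Adjoining one letter *)

Section FreeLetter.
Variables (p : nat) (G : odd_p_class2 p).
Local Notation P := (G * addgroup 'F_p)%type.

Definition letter_exp (a : P) : 'F_p := a.2.
Definition letter_ab (a : P) : baer (ab_module G) := ab_proj a.1.

Fact letter_expM a b : letter_exp (a * b) = (letter_exp a + letter_exp b)%R.
Proof. by []. Qed.
Fact letter_abM a b : letter_ab (a * b) = (letter_ab a + letter_ab b)%R.
Proof. exact: ab_projM. Qed.

(* The coproduct of [G] and a cyclic group of order [p] in the class of groups
   of nilpotency class at most two and exponent [p]. *)
Definition letter_ext : groupType := bilinear_ext letter_expM letter_abM.

Lemma letter_class2 : central_commutators letter_ext.
Proof.
apply: bilinear_class2 => a b c.
by congr (_, _); [exact: class2_central|exact: (@addrC 'F_p)].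
Qed.

Lemma letter_pow (a : letter_ext) : a ^+ p = 1.
Proof.
apply: bilinear_exponent => [|[g c]|m]; [exact: class2_odd| |].
  rewrite addgroupX class2_exp; congr (_, _).
  by rewrite -mulr_natr (pchar_Fp_0 (class2_prime G)) mulr0.
exact: baer_mulrp.
Qed.

Definition letter_odd_p : odd_p_class2 p :=
  OddPClass2 (class2_prime G) (class2_odd G) letter_class2 letter_pow.

Let gl (g : G) : letter_ext := ((g, 0%R), 0%R).
Let t : letter_ext := ((1, 1%R), 0%R).

Let glM : {morph gl : g h / g * h}.
Proof.
move=> g h; rewrite /gl bilinear_mulE /=; congr (_, _).
  by congr (_, _); rewrite [RHS](@addr0 'F_p).
by rewrite /letter_exp /= scale0r !addr0.
Qed.

(** For a lift [g] of [u], this element is the commutator of [g] with the letter. *)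
Lemma letter_derived (u : baer (ab_module G)) :
  @derived_set letter_ext (1, u).
Proof.
have [g <-] := ab_proj_surj u.
have := @bilinear_derived _ _ _ _ _ letter_expM letter_abM
  ((g, 0%R) : P) ((1, 1%R) : P).
rewrite /letter_exp /letter_ab /= scale1r; apply=> //.
by congr (_, _); rewrite ?mulg1 ?mul1g //; exact: (@addrC 'F_p).
Qed.

Lemma letter_extends : extends_by 1 letter_ext G.
Proof.
exists gl; split=> //; first by move=> g h [].
exists [:: t] => //; apply/seteqP; split=> // -[[g c] u] _.
set X := _ `|` _; have [X1 XM XV] := gen_subgroup X.
have tE : (t ^+ (c : 'F_p)).1 = (1, c).
  by rewrite bilinear_fstX /= addgroupX expg1n natr_Zp.
(* The element agrees with [gl g * t ^+ c] over [P], so the two differ by an element of the last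
   factor, which lies in the derived subgroup. *)
rewrite (@bilinear_shift _ _ _ _ _ letter_expM letter_abM ((g, c), u)
  (gl g * t ^+ (c : 'F_p))); last first.
  rewrite /= tE; congr (_, _); first by rewrite mulg1.
  by rewrite [RHS](@add0r 'F_p).
apply: (XM); last by apply: sub_gen_smallest; right; exact: letter_derived.
apply: (XM); first by apply: sub_gen_smallest; left; left; exists g.
elim: (nat_of_ord _) => [|n IH] //; rewrite expgS; apply: (XM) => //.
by apply: sub_gen_smallest; left; right; rewrite /= mem_head.
Qed.

Lemma letter_commute (g : G) : commute (gl g) t -> derived_set g.
Proof.
move=> /bilinear_commuteP[_]; rewrite /letter_exp /= scale1r scale0r.
by move/ab_proj_eq0.
Qed.

Hypothesis ntG : nontrivial G.

Lemma letter_nonabelian : ~ abelian_group letter_ext.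
Proof.
have [g Dg] := not_derived (@class2_central _ G) ntG.
by move=> ab; exact: Dg (letter_commute (ab _ _)).
Qed.

(** The cover uses [baer G] with the half action over the abelianization, and the [G]-coordinate as
    crossed homomorphism [y]. Vanishing of [y] kills an element of [G] itself and not just its class
    modulo commutators. *)
Lemma letter_capable : capable letter_ext.
Proof.
have [g Dg] := not_derived (@class2_central _ G) ntG.
apply: (@bilinear_ext_capable _ P P (baer G) _ letter_exp letter_ab _ _
  id (fun m q => half_conjg m q.1) (fun m => ab_proj (m : G))
  (fun q => q.1 : baer G) _ _ _ _ _ _ _ _ _ _ _ _ (1, 1%R)) => //.
- by move=> a; exists a.
- by move=> m n q; exact: half_conjgD.
- by move=> a m q; exact: half_conjgZ.
- exact: half_conjg1.
- by move=> m q r; exact: half_conjgM.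
- exact: ab_projD.
- exact: ab_projZ.
- by move=> m q; exact: ab_proj_half_conjg.
- exact: ab_proj_surj.
- by move=> q r; exact: mulg_half_conjg.
- exact: half_conjg1.
- exact: baer_mulr2_eq0.
- move=> a /(_ (ab_proj g)) ag; apply: (baer_scale_inj ag).
  by move=> /ab_proj_eq0.
- move=> _ ->; split=> [q||m]; first exact/commute_sym/commute1.
    by [].
  exact: half_conjg1.
- move=> m q /ab_proj_eq0 Dm.
  by rewrite /half_conjg half_commg_eq1 ?addr0 //; apply: derived_commute => //;
    exact: class2_central.
- by move=> [h c] _ /= -> cE; congr (_, _).
Qed.

End FreeLetter.

(** * Dependent commutators *)

Lemma sum_triangle (V : zmodType) d (I : orderType d) (s : seq I)
    (E : I -> I -> V) : (forall i, E i i = 0%R) ->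
  (\sum_(i <- s) \sum_(j <- s) E i j =
   \sum_(i <- s) \sum_(j <- s | (i < j)%O) (E j i + E i j))%R.
Proof.
move=> E0.
have -> : (\sum_(i <- s) \sum_(j <- s) E i j =
    \sum_(i <- s) \sum_(j <- s | (i < j)%O) E i j +
    \sum_(i <- s) \sum_(j <- s | (j < i)%O) E i j)%R.
  rewrite -big_split; apply: eq_bigr => i _ /=.
  rewrite (bigID (fun j => i < j)%O) /=; congr (_ + _)%R.
  rewrite (bigID (fun j => j < i)%O) /= [X in (_ + X)%R]big1 ?addr0 => [|j].
    by apply: eq_bigl => j; case: Order.TotalTheory.ltgtP.
  by case: Order.TotalTheory.ltgtP => // ->; rewrite E0.
rewrite [X in (_ + X)%R](exchange_big_dep xpredT) //= -big_split.
apply: eq_bigr => i _; rewrite -big_split; apply: eq_bigr => j _.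
by rewrite addrC.
Qed.

Section Dependence.
Variables (p : nat) (L : odd_p_class2 p) (B : L -> L -> 'F_p).
Hypothesis BMl : forall g h k, B (g * h) k = (B g k + B h k)%R.
Hypothesis BC : forall g h, B g h = (- B h g)%R.
Hypothesis B_commute : forall g h, commute g h -> B g h = 0%R.

Local Notation V := (baer L * ('F_p)^o)%type.
Let cl2 := @class2_central p L.

(** Carrying the commutator and [B] together lets one expansion, with the same coefficients, serve
    for both. *)
Definition commg_form (g h : L) : V := ([~ g, h], B g h).

Let formMl g h k :
  commg_form (g * h) k = (commg_form g k + commg_form h k)%R.
Proof.
congr (_, _); last exact: BMl.
by rewrite (commgMl cl2) /= [RHS]baer_addE //; apply: cl2.
Qed.

Let formC g h : commg_form g h = (- commg_form h g)%R.
Proof. by congr (_, _); [rewrite -invgR|exact: BC]. Qed.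

Let form_commute g h : commute g h -> commg_form g h = 0%R.
Proof.
by move=> gh; congr (_, _); [exact/eqP/commgP|exact: B_commute].
Qed.

Lemma sum_central (K : Type) (s : seq K) (F : K -> baer L) :
  (forall k (g : L), commute (F k : L) g) ->
  (\sum_(k <- s) F k)%R = \prod_(k <- s) (F k : L).
Proof.
move=> cF; elim: s => [|k s IH]; first by rewrite !big_nil.
by rewrite !big_cons IH baer_addE //; exact: cF.
Qed.

Section Transversal.
Variables (d : Order.disp_t) (I : orderType d) (x : I -> L).
Hypothesis gen_x :
  gen (range (fun i => quot_proj (center L) (x i))) = [set: quot (center L)].

(** Modulo the center [y] is a word in the [x i], and the form is additive and vanishes on the
    center. Allowing every larger list [s'] lets the expansions of several elements share one
    list. *)
Lemma form_expansion (y : L) : exists (s : seq I) (m : I -> 'F_p),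
  forall s', uniq s' -> {subset s <= s'} ->
  forall h, (commg_form y h = \sum_(i <- s') m i *: commg_form (x i) h)%R.
Proof.
pose Y : set L := [set y | exists (s : seq I) (m : I -> 'F_p),
  forall s', uniq s' -> {subset s <= s'} ->
  forall h, (commg_form y h = \sum_(i <- s') m i *: commg_form (x i) h)%R].
have YZ (z : L) : center_set z -> Y z.
  move=> Zz; exists [::], (fun=> 0%R) => s' _ _ h.
  by rewrite form_commute ?big1 // => i _; rewrite scale0r.
have YM a b : Y a -> Y b -> Y (a * b).
  move=> [s [m sm]] [t [n tn]]; exists (s ++ t), (fun i => m i + n i)%R.
  move=> s' us' ss' h; rewrite formMl (sm s') ?(tn s') //.
  - by rewrite -big_split; apply: eq_bigr => i _; rewrite scalerDl.
  - by move=> i si; apply: ss'; rewrite mem_cat si orbT.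
  - by move=> i si; apply: ss'; rewrite mem_cat si.
have YV a : Y a -> Y a^-1.
  move=> [s [m sm]]; exists s, (fun i => - m i)%R => s' us' ss' h.
  apply: (addrI (commg_form a h)); rewrite -formMl mulgV.
  rewrite form_commute; last exact/commute_sym/commute1.
  rewrite (sm s') // -big_split big1 // => i _.
  by rewrite scaleNr /= subrr.
have Yx i : Y (x i).
  exists [:: i], (fun j => (j == i)%:R)%R => s' us' ss' h.
  rewrite (bigD1_seq i) ?ss' ?mem_head //= eqxx scale1r big1 ?addr0 //.
  by move=> j /negPf ->; rewrite scale0r.
suff : forall q : quot (center L), exists2 y, quot_proj (center L) y = q & Y y.
  move=> /(_ (quot_proj (center L) y))[y' /quot_projP Zy Yy'].
  by rewrite -[y](mulVKg y'); apply: YM => //; apply: YZ.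
move=> q; have : gen (range (fun i => quot_proj (center L) (x i))) q.
  by rewrite gen_x.
have qM := @quot_projM L (center L).
apply: (gen_min (H := [set q | exists2 y, quot_proj (center L) y = q & Y y])).
  split=> [|_ _ [a <- Ya] [b <- Yb]|_ [a <- Ya]] /=.
  - exists 1; first exact: (hom1 qM).
    by apply: YZ; have [[]] := center_normal L.
  - by exists (a * b); [exact: qM|exact: YM].
  - by exists a^-1; [exact: homV|exact: YV].
by move=> _ [i _ <-]; exists (x i).
Qed.

Lemma form_expansion2 (u v : L) : exists (s : seq I) (m : I -> I -> 'F_p),
  forall s', uniq s' -> {subset s <= s'} ->
  (commg_form u v =
   \sum_(i <- s') \sum_(j <- s') m i j *: commg_form (x i) (x j))%R.
Proof.
have [s [m sm]] := form_expansion u; have [t [n tn]] := form_expansion v.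
exists (s ++ t), (fun i j => m i * n j)%R => s' us' ss'.
rewrite (sm s') // => [|i si]; last by apply: ss'; rewrite mem_cat si.
apply: eq_bigr => i _; rewrite formC (tn s') // => [|j tj]; last first.
  by apply: ss'; rewrite mem_cat tj orbT.
rewrite -sumrN scaler_sumr; apply: eq_bigr => j _.
by rewrite -scalerN -formC scalerA.
Qed.

End Transversal.

(** Independence would allow the coefficients to be read off from the commutator, so equal
    commutators would force equal values of [B]. *)
Lemma dependent_commutators (u v a b : L) :
  [~ u, v] = [~ a, b] -> B u v <> B a b ->
  forall d (I : orderType d) (x : I -> L), transversal p x ->
    ~ independent p (nontrivial_commutators (x := x)).
Proof.
move=> uvab nB d I x [genx _] indep; apply: nB.
have [s [m sm]] := form_expansion2 genx u v.
have [t [n tn]] := form_expansion2 genx a b.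
pose r := undup (s ++ t); have ur : uniq r by exact: undup_uniq.
have sr : {subset s <= r} by move=> i si; rewrite mem_undup mem_cat si.
have tr : {subset t <= r} by move=> i si; rewrite mem_undup mem_cat si orbT.
pose e i j := (m i j - n i j)%R.
(* The two orders of a pair contribute with opposite signs; [c] is the resulting coefficient of
   [[~ x j, x i]] for [i < j]. *)
pose c (ij : I * I) := (e ij.2 ij.1 - e ij.1 ij.2)%R.
pose K := [pred ij : I * I | (ij.1 < ij.2)%O && ([~ x ij.2, x ij.1] != 1)].
have dE : (commg_form u v - commg_form a b =
    \sum_(ij <- [seq (i, j) | i <- r, j <- r] | K ij)
       c ij *: commg_form (x ij.2) (x ij.1))%R.
  rewrite (sm r) // (tn r) // -sumrB.
  under eq_bigr => i _ do rewrite -sumrB.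
  under eq_bigr => i _ do under eq_bigr => j _ do rewrite -scalerBl -/(e i j).
  rewrite sum_triangle => [|i]; last first.
    by rewrite form_commute ?scaler0 //; exact: commute_refl.
  rewrite [RHS]big_mkcond big_allpairs_dep /=; apply: eq_bigr => i _.
  rewrite big_mkcond; apply: eq_bigr => j _ /=.
  case: (i < j)%O => //=; rewrite [X in (_ + _ *: X)%R]formC scalerN -scalerBl.
  (* Pairs with trivial commutator drop out of both coordinates, because [B] vanishes on commuting
     elements. *)
  by case: eqP => // /eqP/commgP xij; rewrite form_commute // scaler0.
pose q : seq {ij : I * I | K ij} := pmap insub [seq (i, j) | i <- r, j <- r].
have qE : map val q = [seq ij <- [seq (i, j) | i <- r, j <- r] | K ij].
  rewrite /q (pmap_filter (insubK _)); apply: eq_filter => ij.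
  by rewrite /= isSome_insub.
have uq : uniq q by apply/pmap_sub_uniq/allpairs_uniq => // -[? ?] [? ?].
rewrite -big_filter -qE big_map in dE.
(* The first coordinate of [dE] is a relation among the nontrivial commutators, with the
   representatives of the coefficients as exponents. *)
have c0 k : k \in q -> c (val k) = 0%R.
  move=> kq; have := indep q (fun k => nat_of_ord (c (val k))) uq _ k kq.
  rewrite (dvdn_pcharf (pchar_Fp (class2_prime L))) natr_Zp => H.
  apply/eqP/H; move/(congr1 fst): dE; rewrite /= uvab subrr.
  rewrite (raddf_sum fst) /= sum_central => [dE|ij g].
    rewrite [RHS]dE; apply: eq_bigr => ij _.
    by rewrite baer_scaleE.
  by rewrite baer_scaleE; exact/commute_sym/commuteX/commute_sym/cl2.
move/(congr1 snd): dE; rewrite (raddf_sum snd) big1_seq => [|k /andP[_ kq]].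
  by move/eqP; rewrite subr_eq0 => /eqP.
by rewrite c0 // scale0r.
Qed.
End Dependence.

(** * Adjoining two letters *)

(* [F * F] acts componentwise, so that extensions by two letters are bilinear
   extensions with a single exponent in [F * F]. *)
Definition square (F : comNzRingType) (V : lmodType F) : Type := (V * V)%type.

Section Square.
Variables (F : comNzRingType) (V : lmodType F).

HB.instance Definition _ := GRing.Zmodule.on (square V).

Definition square_scale (c : F * F) (m : square V) : square V :=
  (c.1 *: m.1, c.2 *: m.2)%R.

Fact square_scaleA a b m :
  square_scale a (square_scale b m) = square_scale (a * b)%R m.
Proof. by congr (_, _); rewrite /= scalerA. Qed.

Fact square_scale1 : left_id (1%R : F * F) square_scale.
Proof. by move=> [s t]; congr (_, _); rewrite /= scale1r. Qed.

Fact square_scaleDr : right_distributive square_scale +%R.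
Proof. by move=> a m n; congr (_, _); rewrite /= scalerDr. Qed.

Fact square_scaleDl m : {morph square_scale^~ m : a b / (a + b)%R}.
Proof. by move=> a b; congr (_, _); rewrite /= scalerDl. Qed.

HB.instance Definition _ :=
  GRing.Zmodule_isLmodule.Build (F * F)%type (square V)
    square_scaleA square_scale1 square_scaleDr square_scaleDl.

End Square.

Section TwoLetters.
Variables (p : nat) (G : odd_p_class2 p) (u v : G).
Local Notation F := 'F_p.
Local Notation P := (G * addgroup (F * F)%type)%type.
Local Notation U := (baer (ab_module G)).

Definition pair_exp (a : P) : F * F := a.2.
Definition pair_ab (a : P) : U :=
  (ab_proj a.1 - a.2.1 *: ab_proj u - a.2.2 *: ab_proj v)%R.
(** One copy of [U] for the commutators with each letter; the componentwise scalars weight them by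
    the two exponents. *)
Definition pair_diag (a : P) : square U := (pair_ab a, pair_ab a).

Fact pair_expM a b : pair_exp (a * b) = (pair_exp a + pair_exp b)%R.
Proof. by []. Qed.

Lemma pair_abM a b : pair_ab (a * b) = (pair_ab a + pair_ab b)%R.
Proof.
rewrite /pair_ab -[(a * b).2.1]/(a.2.1 + b.2.1)%R.
rewrite -[(a * b).2.2]/(a.2.2 + b.2.2)%R ab_projM !scalerDl !opprD.
by addr_ac.
Qed.

Fact pair_diagM a b : pair_diag (a * b) = (pair_diag a + pair_diag b)%R.
Proof. by rewrite /pair_diag pair_abM. Qed.

(* Two letters [a], [b] are freely adjoined to [G] in the class of groups of
   nilpotency class at most two and exponent [p], subject to
   [[~ a, b] = [~ u, v]].  The first coordinate is the retraction onto [G] that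
   sends [a] to [u] and [b] to [v]; [pair_ab] is the map to the abelianization
   of [G] that kills [a] and [b]. *)
Definition pair_ext : groupType := bilinear_ext pair_expM pair_diagM.

Let gl (g : G) : pair_ext := ((g, 0%R), 0%R).
(** These retract to 1: modulo the derived subgroup, [letter (1, 0)] is [u^-1 * a] and
    [letter (0, 1)] is [v^-1 * b]. *)
Let letter (c : F * F) : pair_ext := ((1, c), 0%R).

Let glM : {morph gl : g h / g * h}.
Proof.
move=> g h; rewrite /gl bilinear_mulE /=; congr (_, _).
  by congr (_, _); rewrite [RHS](@addr0 (F * F)%type).
by rewrite /pair_exp /= scale0r !addr0.
Qed.

Definition exp1 (a : pair_ext) : F := a.1.2.1.
Definition exp2 (a : pair_ext) : F := a.1.2.2.
Definition ext_ab (a : pair_ext) : U := pair_ab a.1.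

Lemma exp1M a b : exp1 (a * b) = (exp1 a + exp1 b)%R. Proof. by []. Qed.
Lemma exp2M a b : exp2 (a * b) = (exp2 a + exp2 b)%R. Proof. by []. Qed.
Lemma ext_abM a b : ext_ab (a * b) = (ext_ab a + ext_ab b)%R.
Proof. exact: pair_abM. Qed.

Lemma ext_ab_gl g : ext_ab (gl g) = ab_proj g.
Proof. by rewrite /ext_ab /pair_ab /= !scale0r !subr0. Qed.

Lemma pair_commuteP (a b : pair_ext) : commute a b <->
  [/\ commute a.1.1 b.1.1, (exp1 b *: ext_ab a = exp1 a *: ext_ab b)%R
    & (exp2 b *: ext_ab a = exp2 a *: ext_ab b)%R].
Proof.
split=> [/bilinear_commuteP[/(congr1 fst) c E]|[c E1 E2]].
  split=> //; first exact: (congr1 fst E).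
  exact: (congr1 snd E).
apply/bilinear_commuteP; split; last by congr (_, _).
by congr (_, _); [exact: c|exact: (@addrC (F * F)%type)].
Qed.

Lemma pair_class2 : central_commutators pair_ext.
Proof.
apply: bilinear_class2 => a b c.
by congr (_, _); [exact: class2_central|exact: (@addrC (F * F)%type)].
Qed.

Lemma pair_pow (a : pair_ext) : a ^+ p = 1.
Proof.
have F0 (i : F) : (i *+ p = 0)%R.
  by rewrite -mulr_natr (pchar_Fp_0 (class2_prime G)) mulr0.
apply: bilinear_exponent => [|[g [i j]]|[s t]]; first exact: class2_odd.
  rewrite addgroupX class2_exp; congr (_, _).
  rewrite pairMnE.
  by rewrite !F0.
rewrite -[LHS]/((s, t) *+ p)%R pairMnE.
by rewrite !baer_mulrp.
Qed.

Definition pair_odd_p : odd_p_class2 p :=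
  OddPClass2 (class2_prime G) (class2_odd G) pair_class2 pair_pow.

(** Commutators of [G] with the two letters fill the two copies of [U] separately. *)
Lemma pair_derived (m : square U) : @derived_set pair_ext (1, m).
Proof.
have [_ DM _] := (derived_normal pair_ext).1.
have D (c : F * F) g :
    derived_set ((1, (c *: ((ab_proj g, ab_proj g) : square U))%R) : pair_ext).
  have := @bilinear_derived _ _ _ _ _ pair_expM pair_diagM
    ((g, 0%R) : P) ((1, c) : P).
  rewrite /pair_exp /pair_diag /pair_ab /= !scale0r !subr0; apply=> //.
  by congr (_, _); rewrite ?mulg1 ?mul1g //; exact: (@addrC (F * F)%type).
case: m => s t; have [g <-] := ab_proj_surj s; have [h <-] := ab_proj_surj t.
have := DM _ _ (D (1, 0)%R g) (D (0, 1)%R h).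
congr (derived_set _); rewrite bilinear_mulE /= mul1g /pair_exp /= scale0r addr0.
congr (_, _); congr (_, _); rewrite /= ?scale1r ?scale0r ?addr0 ?add0r //.
Qed.

Lemma pair_extends : extends_by 2 pair_ext G.
Proof.
exists gl; split=> //; first by move=> g h [].
exists [:: letter (1, 0)%R; letter (0, 1)%R] => //.
apply/seteqP; split=> // -[[g [i j]] m] _.
set X := _ `|` _; have [X1 XM XV] := gen_subgroup X.
have XX a n : gen X a -> gen X (a ^+ n).
  by move=> Xa; elim: n => [|n IH] //; rewrite expgS; apply: (XM).
have lE c n : (letter c ^+ n).1 = (1, (c *+ n)%R).
  by rewrite bilinear_fstX /= addgroupX expg1n.
rewrite (@bilinear_shift _ _ _ _ _ pair_expM pair_diagM ((g, (i, j)), m)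
  (gl g * letter (1, 0)%R ^+ i * letter (0, 1)%R ^+ j)); last first.
  rewrite /= !lE.
  transitivity ((g * 1 * 1, (0 + (1, 0) *+ i + (0, 1) *+ j)%R) : P) => //.
  rewrite !mulg1 add0r !pairMnE /= !mul0rn !natr_Zp.
  by congr (_, (_, _)); rewrite /= ?addr0 ?add0r.
apply: (XM); last by apply: sub_gen_smallest; right; exact: pair_derived.
apply: (XM); last apply: (XX).
  apply: (XM); last apply: (XX).
    by apply: sub_gen_smallest; left; left; exists g.
  by apply: sub_gen_smallest; left; right; rewrite /= mem_head.
by apply: sub_gen_smallest; left; right; rewrite /= mem_seq2 eqxx orbT.
Qed.

(** * Capability, center and indecomposability of the extension by two letters *)

Hypothesis ntG : nontrivial G.

Lemma ab_nonzero : exists g : G, ab_proj g <> 0%R.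
Proof.
have [g Dg] := not_derived (@class2_central _ G) ntG.
by exists g => /ab_proj_eq0.
Qed.

(** Here the module is [square U] with trivial action, and a cover [K] of [G] detects the elements
    of [G]. The exponent [(1, 1)] of [q0] is the unit of the ring [F * F]. *)
Lemma pair_capable : capable G -> capable pair_ext.
Proof.
move=> /capable_cover[K [f [fM f_surj f_ker]]].
have [g g0] := ab_nonzero.
pose Q := (K * addgroup (F * F)%type)%type.
pose phi (q : Q) : P := (f q.1, q.2).
have phiM : {morph phi : a b / a * b} by move=> a b; rewrite /phi /= fM.
apply: (@bilinear_ext_capable _ P Q (square U) _ pair_exp pair_diag _ _
  phi (fun m q => m) id (fun q => pair_diag (phi q)) phiM
  _ _ _ _ _ _ _ _ _ _ _ (1, (1, 1)%R)) => //.
- by move=> [h c]; have [k <-] := f_surj h; exists (k, c).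
- by move=> m; exists m.
- by move=> q r; rewrite phiM pair_diagM.
- move=> [s t] E; congr (_, _); apply: baer_mulr2_eq0.
    exact: (congr1 fst E).
  exact: (congr1 snd E).
- move=> [i j] H; have := H (ab_proj g, ab_proj g) => E.
  congr (_, _); [have := congr1 fst E|have := congr1 snd E] => /= E';
    exact: baer_scale_inj E' g0.
- move=> [k c] E; split=> //; last by rewrite E (log1 pair_diagM).
  move: E => [/f_ker Zk _] [h e]; congr (_, _); first exact: Zk.
  exact: (@addrC (F * F)%type).
- move=> [k c] Zq _ cE; congr (_, _) => //=; apply/f_ker => h.
  by have := Zq (h, 0%R) => -[].
Qed.

(** Commuting with an element of [G] outside its derived subgroup kills the exponents; commuting
    with a letter then kills [ext_ab]. *)
Lemma pair_center (a : pair_ext) : center_set a ->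
  [/\ exp1 a = 0%R, exp2 a = 0%R & ext_ab a = 0%R].
Proof.
have [g g0] := ab_nonzero.
move=> Za; have /pair_commuteP[_] := Za (gl g); rewrite !ext_ab_gl.
rewrite -[exp1 (gl g)]/(0%R : F) -[exp2 (gl g)]/(0%R : F) !scale0r.
move=> /esym/baer_scale_inj/(_ g0) a1 /esym/baer_scale_inj/(_ g0) a2.
split=> //; have /pair_commuteP[_ + _] := Za (letter (1, 0)%R).
by rewrite -[exp1 (letter _)]/(1%R : F) scale1r a1 scale0r.
Qed.

Lemma pair_center_derived : center pair_ext = derived pair_ext :> set pair_ext.
Proof.
apply/seteqP; split=> a; last first.
  by move=> Da b; apply: derived_commute => //; exact: pair_class2.
move=> /pair_center[]; case: a => [[g [i j]] m].
rewrite /exp1 /exp2 /ext_ab /pair_ab /= => -> ->; rewrite !scale0r !subr0.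
move=> /ab_proj_eq0 Dg.
rewrite (@bilinear_shift _ _ _ _ _ pair_expM pair_diagM ((g, (0, 0)%R), m)
  (gl g)) //.
have [_ DM _] := (derived_normal pair_ext).1.
by apply: DM; [exact: hom_derived|exact: pair_derived].
Qed.

Lemma pair_center_sufficient (a : pair_ext) :
  exp1 a = 0%R -> exp2 a = 0%R -> ext_ab a = 0%R -> center_set a.
Proof.
move=> a1 a2 a0 b; apply/pair_commuteP; rewrite a1 a2 a0 !scale0r !scaler0.
split=> //; apply: derived_commute; first exact: class2_central.
apply/ab_proj_eq0; move: a0; rewrite /ext_ab /pair_ab.
by rewrite [a.1.2.1]a1 [a.1.2.2]a2 !scale0r !subr0.
Qed.

(** If [l] were nonzero somewhere on both factors, commutation would make [ext_ab] proportional to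
    [l] throughout them. Factoring an element of [G], where [l] vanishes, would then give it trivial
    image in the abelianization. *)
Lemma factor_without_letter (C D : set pair_ext) (l : pair_ext -> F) c0 :
  (forall g, exists c d, [/\ C c, D d & g = c * d]) ->
  (forall c d, C c -> D d -> commute c d) ->
  (forall a b, l (a * b) = (l a + l b)%R) -> (forall g, l (gl g) = 0%R) ->
  (forall a b, commute a b -> (l b *: ext_ab a = l a *: ext_ab b)%R) ->
  C c0 -> l c0 <> 0%R -> forall d, D d -> l d = 0%R /\ ext_ab d = 0%R.
Proof.
move=> CD comm lM lgl lcomm Cc0 lc0.
have inj a (w : U) : (l a *: w = 0)%R -> l a <> 0%R -> w = 0%R.
  move=> E la; apply: contrapT => w0; exact: la (baer_scale_inj E w0).
have lD d : D d -> l d = 0%R.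
  move=> Dd; apply: contrapT => ld.
  have [g g0] := ab_nonzero; apply: g0.
  have [c [d' [Cc Dd' gE]]] := CD (gl g).
  have ab_gl : ab_proj g = (ext_ab c + ext_ab d')%R.
    by rewrite -ext_abM -gE ext_ab_gl.
  have l0 : (l c + l d' = 0)%R by rewrite -lM -gE lgl.
  apply: (inj d) => //; apply: (inj c0) => //.
  rewrite ab_gl scalerDr (lcomm _ _ (comm _ _ Cc Dd)) scalerDr.
  have -> : (l c0 *: (l d *: ext_ab d') = l c0 *: (l d' *: ext_ab d))%R.
    rewrite scalerA mulrC -scalerA -(lcomm _ _ (comm _ _ Cc0 Dd')).
    rewrite scalerA mulrC -scalerA (lcomm _ _ (comm _ _ Cc0 Dd)).
    by rewrite scalerA mulrC -scalerA.
  by rewrite -scalerDr -scalerDl l0 scale0r scaler0.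
move=> d Dd; split; first exact: lD.
apply: (inj c0) => //.
by rewrite -(lcomm _ _ (comm _ _ Cc0 Dd)) lD // scale0r.
Qed.

(** If [exp2] were nonzero on some element of [D], the preceding lemma with the factors exchanged
    would make [ext_ab] vanish on [C] as well as on [D], hence on all of [G]. *)
Lemma factor_without_letters (C D : set pair_ext) c0 :
  (forall g, exists c d, [/\ C c, D d & g = c * d]) ->
  (forall c d, C c -> D d -> commute c d) ->
  C c0 -> exp1 c0 <> 0%R -> D `<=` @center_set pair_ext.
Proof.
move=> CD comm Cc0 c1.
have cm1 a b : commute a b -> (exp1 b *: ext_ab a = exp1 a *: ext_ab b)%R.
  by move=> /pair_commuteP[].
have cm2 a b : commute a b -> (exp2 b *: ext_ab a = exp2 a *: ext_ab b)%R.
  by move=> /pair_commuteP[].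
have D1 := factor_without_letter CD comm exp1M (fun g => erefl) cm1 Cc0 c1.
move=> d Dd; have [d1 d0] := D1 _ Dd.
apply: pair_center_sufficient => //; apply: contrapT => d2.
have DC g : exists d c, [/\ D d, C c & g = d * c].
  by have [c [d' [Cc Dd' ->]]] := CD g; exists d', c; split=> //; exact: comm.
have comm' c e : D c -> C e -> commute c e.
  by move=> Dc Ce; apply/commute_sym/comm.
have C0 := factor_without_letter DC comm' exp2M (fun g => erefl) cm2 Dd d2.
have [g g0] := ab_nonzero; apply: g0; rewrite -ext_ab_gl.
have [c [d' [Cc Dd' ->]]] := CD (gl g).
by rewrite ext_abM (C0 _ Cc).2 (D1 _ Dd').2 addr0.
Qed.

(** When [D] is central, all commutators come from [C], so [C] contains the derived subgroup, which
    is the center. *)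
Lemma central_factor (C D : set pair_ext) :
  subgroup C -> (forall g, exists c d, [/\ C c, D d & g = c * d]) ->
  D `<=` @center_set pair_ext -> D `<=` C.
Proof.
move=> sC CD DZ d Dd; have : (center pair_ext : set pair_ext) d by exact: DZ.
rewrite pair_center_derived; apply: (gen_min sC) => {d Dd}.
move=> _ [a _ [b _ <-]].
have [c [z [Cc Dz ->]]] := CD a; have [e [w [Ce Dw ->]]] := CD b.
have Z (x y : pair_ext) : center_set x -> [~ x, y] = 1 /\ [~ y, x] = 1.
  move=> Zx; split; apply/eqP/commgP; first exact: Zx.
  exact/commute_sym/Zx.
rewrite !(commgMl pair_class2) !(commgMr pair_class2).
rewrite !(Z _ _ (DZ _ Dz)).1 !(Z _ _ (DZ _ Dw)).2 !mulg1.
have [C1 CM CV] := sC.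
by rewrite /commg /conjg; do ?[apply: (CM)|apply: (CV)].
Qed.

(** A letter with [exp1] equal to 1 forces a nonzero [exp1] in one factor; the other factor is then
    central and contained in it. *)
Lemma pair_indecomposable (C D : set pair_ext) :
  central_product C D -> trivial_decomposition C D.
Proof.
move=> [sC sD CD com1].
have comm c d : C c -> D d -> commute c d.
  move=> Cc Dd; apply/commgP/eqP.
  have : commutator_subgroup C D [~ c, d].
    by apply: sub_gen_smallest; exists c => //; exists d.
  by rewrite com1.
have DC g : exists d c, [/\ D d, C c & g = d * c].
  by have [c [d' [Cc Dd' ->]]] := CD g; exists d', c; split=> //; exact: comm.
have comm' c e : D c -> C e -> commute c e.
  by move=> Dc Ce; apply/commute_sym/comm.
have [c [d [Cc Dd cd]]] := CD (letter (1, 0)%R).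
have : (exp1 c + exp1 d = 1)%R by rewrite -exp1M -cd.
have [c1|/eqP c1 _] := eqVneq (exp1 c) 0%R.
  rewrite c1 add0r => d1; left; apply: (central_factor sD DC).
  apply: (factor_without_letters DC comm' Dd) => d0.
  by have := oner_neq0 F; rewrite -d1 d0 eqxx.
right; apply: (central_factor sC CD).
exact: (factor_without_letters CD comm Cc c1).
Qed.

(** * The determinant of the exponents *)

Hypothesis uv : [~ u, v] != 1.

Definition exp_det (a b : pair_ext) : F :=
  (exp1 a * exp2 b - exp2 a * exp1 b)%R.

(** If the determinant were nonzero, proportionality would force both [ext_ab] to vanish. The
    [G]-coordinates would then be words in [u] and [v] modulo the derived subgroup, with commutator
    [[~ u, v]] to the power of the determinant. *)
Lemma exp_det_commute a b : commute a b -> exp_det a b = 0%R.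
Proof.
move=> cab; have [cG E1 E2] := (pair_commuteP a b).1 cab.
apply: contrapT => d0.
have a0 : ext_ab a = 0%R.
  apply: contrapT => a0; apply: d0; apply: (baer_scale_inj _ a0).
  rewrite scalerBl -!scalerA E1 E2 !scalerA [(exp1 a * _)%R]mulrC.
  by rewrite subrr.
have b0 : ext_ab b = 0%R.
  apply: contrapT => b0; apply: d0; apply: (baer_scale_inj _ b0).
  rewrite scalerBl [(exp1 a * _)%R]mulrC [(exp2 a * _)%R]mulrC -!scalerA.
  by rewrite -E1 -E2 !scalerA [(exp1 b * _)%R]mulrC subrr.
have split_ab (c : pair_ext) : ext_ab c = 0%R ->
    exists2 z, derived_set z & c.1.1 = u ^+ (exp1 c) * v ^+ (exp2 c) * z.
  move=> c0; exists ((u ^+ (exp1 c) * v ^+ (exp2 c))^-1 * c.1.1).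
    apply/ab_proj_eq0; rewrite ab_projM (logV (@ab_projM p G)) ab_projM.
    rewrite !(logX (@ab_projM p G)) opprD addrC addrA; exact: c0.
  by rewrite mulVKg.
have [z /(derived_commute (@class2_central _ G)) Zz aE] := split_ab _ a0.
have [w /(derived_commute (@class2_central _ G)) Zw bE] := split_ab _ b0.
have cl2 := @class2_central _ G.
have cz s : [~ z, s] = 1 by exact/eqP/commgP.
have cw s : [~ s, w] = 1 by exact/eqP/commgP/commute_sym.
have [/commgP/eqP] := cG; rewrite aE bE.
rewrite !(commgMl cl2) !(commgMr cl2) !cz !cw !(commgXl cl2) !(commgXr cl2).
rewrite !commgg !expg1n !mul1g !mulg1 -[[~ v, u]]invgR => E.
pose c : baer G := [~ u, v].
have : (exp1 a *: (exp2 b *: c) - exp2 a *: (exp1 b *: c) = 0)%R.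
  rewrite !baer_scaleE; apply: etrans E; rewrite baer_addE; last first.
    exact/commuteV/commuteX/commuteX/commute_sym/commuteX/commuteX/commute_refl.
  by rewrite !expVgn.
rewrite !scalerA -scalerBl => /baer_scale_inj dc; apply/d0/dc.
by move=> c1; case/eqP: uv.
Qed.

(** Both [a] and [b] have trivial [pair_diag], so their commutator is that of [u] and [v] in [G];
    but the determinant is 1 at [(a, b)] and 0 at [(gl u, gl v)]. *)
Lemma pair_dependent d (I : orderType d) (x : I -> pair_ext) :
  transversal p x -> ~ independent p (nontrivial_commutators (x := x)).
Proof.
pose a : pair_ext := ((u, (1, 0)%R), 0%R).
pose b : pair_ext := ((v, (0, 1)%R), 0%R).
have diag0 (c : pair_ext) : ext_ab c = 0%R -> pair_diag c.1 = 0%R.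
  by move=> c0; congr (_, _).
have a0 : pair_diag a.1 = 0%R.
  by apply: diag0; rewrite /ext_ab /pair_ab /= scale1r scale0r subr0 subrr.
have b0 : pair_diag b.1 = 0%R.
  by apply: diag0; rewrite /ext_ab /pair_ab /= scale1r scale0r subr0 subrr.
have abE : [~ gl u, gl v] = [~ a, b].
  rewrite -(homR glM); apply: (@mulgI _ (b * a)); rewrite -commgC.
  rewrite !bilinear_mulE a0 b0 !scaler0 [pair_exp (gl _).1]/(0%R) scale0r !addr0.
  congr (_, _); rewrite -[(gl _).1]/([~ u, v], 0%R).
  congr (_, _); first exact/esym/commgC.
  by rewrite /= [LHS](@addr0 (F * F)%type); exact: (@addrC (F * F)%type).
have dM g h k : exp_det (g * h) k = (exp_det g k + exp_det h k)%R.
  by rewrite /exp_det exp1M exp2M !mulrDl opprD; addr_ac.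
have dC g h : exp_det g h = (- exp_det h g)%R.
  by rewrite /exp_det opprB mulrC [(exp2 g * _)%R]mulrC.
have nab : exp_det (gl u) (gl v) <> exp_det a b.
  rewrite /exp_det -[exp1 (gl u)]/(0%R : F) -[exp2 (gl u)]/(0%R : F).
  rewrite -[exp1 a]/(1%R : F) -[exp2 a]/(0%R : F) -[exp2 b]/(1%R : F).
  by rewrite !mul0r mulr1 => /eqP; rewrite !subr0 eq_sym (negPf (oner_neq0 F)).
exact: (@dependent_commutators p pair_odd_p exp_det dM dC exp_det_commute
  (gl u) (gl v) a b abE nab d I x).
Qed.

End TwoLetters.

(** * Transfer to the original group and conclusion *)

Lemma extends_by_has_exponent k n (H G : groupType) : extends_by k H G ->
  has_exponent G n -> (forall x : H, x ^+ n = 1) -> has_exponent H n.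
Proof.
move=> [f [fM fI _]] [n0 _ nmin] Hn; split=> // m m0 Hm; apply: nmin => // x.
by apply: fI; rewrite (homX _ fM) Hm (hom1 fM).
Qed.

Lemma extends_by_contains_copy k (H G : groupType) :
  extends_by k H G -> contains_copy H G.
Proof.
move=> [f [fM fI _]]; exists (range f).
  split=> [|_ _ [a _ <-] [b _ <-]|_ [a _ <-]].
  - by exists 1 => //; exact: hom1.
  - by exists (a * b) => //; exact: fM.
  - by exists a^-1 => //; exact: homV.
pose fm := isMultiplicative.Build _ _ f fM.
pose fh : {multiplicative G -> H} := HB.pack f fm.
exists fh; split=> [x _|x y _ _ /fI //|y [x _ <-]]; last by exists x.
by exists x.
Qed.

(** [G0] is the original group and [G] the one that receives the two letters; [k] counts the
    generators spent on reaching [G], either none or the one free letter. *)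
Lemma nonabelian_capable_embedding p (G : odd_p_class2 p) (k : nat)
    (G0 : groupType) :
  has_exponent G0 p -> extends_by k G G0 -> ~ abelian_group G -> capable G ->
  exists G1 : groupType,
    [/\ capable G1, class_R p G1 & extends_by (k + 2) G1 G0].
Proof.
move=> expG0 GG0 nab capG.
have [u [v uv]] : exists u v : G, [~ u, v] != 1.
  apply: contrapT => nuv; apply: nab => u v; apply/commgP.
  by apply/negP => uv; apply: nuv; exists u, v; apply/negP.
have ntG : nontrivial G by exists u => u1; move: uv; rewrite u1 comm1g eqxx.
have ext : extends_by (k + 2) (pair_ext u v) G0.
  by apply: extends_by_comp GG0; exact: pair_extends.
exists (pair_ext u v); split=> //; first exact: pair_capable.
split.
- split; first by move=> x; exists 1%N; rewrite expn1; exact: pair_pow.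
  by apply: extends_by_has_exponent ext expG0 _; exact: pair_pow.
- exact: pair_indecomposable.
- exact: pair_center_derived.
- exact: pair_dependent.
Qed.

Theorem theorem3p1 (p : nat) (G : groupType) :
  prime p -> odd p ->
  nontrivial G -> nilpotency_class_le G 2 -> has_exponent G p ->
  [/\ exists G1 : groupType,
        [/\ capable G1, class_R p G1 & contains_copy G1 G],
      ~ abelian_group G /\ capable G ->
        exists G1 : groupType,
          [/\ capable G1, class_R p G1, contains_copy G1 G
            & rank_le_add (abelianization G1) (abelianization G) 2]
    & ~ (~ abelian_group G /\ capable G) ->
        exists G1 : groupType,
          [/\ capable G1, class_R p G1, contains_copy G1 G
            & rank_le_add (abelianization G1) (abelianization G) 3]].
Proof.
move=> pr od ntG /nilpotency_class_le2 cl2 expG.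
have [_ powG _] := expG; pose H := OddPClass2 pr od cl2 powG.
have case1 : ~ abelian_group G /\ capable G -> exists G1 : groupType,
    [/\ capable G1, class_R p G1 & extends_by 2 G1 G].
  move=> [nab capG].
  apply: (@nonabelian_capable_embedding p H 0 G) => //.
  exists id; split=> //; exists [::] => //; apply/seteqP; split=> // x _.
  by apply: sub_gen_smallest; left; left; exists x.
have case2 : exists G1 : groupType,
    [/\ capable G1, class_R p G1 & extends_by 3 G1 G].
  apply: (@nonabelian_capable_embedding p (letter_odd_p H) 1 G) => //.
  - exact: (letter_extends H).
  - exact: (@letter_nonabelian p H ntG).
  - exact: (@letter_capable p H ntG).
split.
- have [G1 [cap1 R1 ext1]] := case2.
  by exists G1; split=> //; exact: extends_by_contains_copy ext1.
- move=> /case1[G1 [cap1 R1 ext1]]; exists G1; split=> //.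
    exact: extends_by_contains_copy ext1.
  exact: extends_by_rank.
- move=> _; have [G1 [cap1 R1 ext1]] := case2; exists G1; split=> //.
    exact: extends_by_contains_copy ext1.
  exact: extends_by_rank.
Qed.
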